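(* Let $\tau=\frac12(1+\sqrt5)$, let $\mathbf{Z}_\tau^+$ be the set of non-negative $\tau$-integers, and for $k\in\mathbb{Z}$ let $\mathbf{a}^k:=\tau^{-k}\mathbf{Z}_\tau^+$, a knot sequence in $J=\mathbb{R}_+=[0,\infty)$. Let $\boldsymbol{\theta}^k=(\theta_a)_{a\in\mathbf{a}^k}$ be the constant parameter sequence $\theta_a=1/\tau$, and let $V^k:=S(\Omega_{\mathbf{a}^k,\boldsymbol{\theta}^k})$. Then the spaces $V^k$ form a multiresolution analysis of $L^2(\mathbb{R}_+)$, that is: (1) $V^k\subset V^{k+1}$ for all $k\in\mathbb{Z}$; (2) $\bigcup_k V^k$ is dense in $L^2(\mathbb{R}_+)$; (3) $\bigcap_k V^k=\{0\}$.
   Context: A non-negative number $x$ is a $\tau$-integer if it can be written $x=\sum_{k=0}^{n}\varepsilon_k\tau^k$ with an integer $n\ge 0$ and each $\varepsilon_k\in\{0,1\}$. A knot sequence in an interval $J\subset\mathbb{R}$ is a set $\mathbf{a}\subset J$ with at least three elements, having no cluster point in $J$, and with $\inf\mathbf{a}=\inf J$, $\sup\mathbf{a}=\sup J$. For $a\in\mathbf{a}$, $a_+$ and $a_-$ denote the successor and predecessor of $a$ in $\mathbf{a}$ (with $a_-=-\infty$ if $a=\inf J$). For a locally finite collection $\Omega\subset L^2(J)$, $S(\Omega):=\operatorname{clos}_{L^2(J)}\operatorname{span}(\Omega)$. Construction of $\Omega_{\mathbf{a},\boldsymbol{\theta}}$ for a knot sequence $\mathbf{a}$ in $J=[0,\infty)$.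 Let $r(x)=x\chi_{[0,1)}(x)$, $l(x)=(1-x)\chi_{[0,1)}(x)$, $q=4rl$. For $0<\theta<1$ let $q_0^\theta(x)=q(x/\theta)$, $q_1^\theta(x)=q((x-\theta)/(1-\theta))$, $h^\theta(x)=r(x/\theta)+l((x-\theta)/(1-\theta))$. For each $\theta\in(0,1)$ there is a nonzero function $z^\theta\in\operatorname{span}\{q_0^\theta,q_1^\theta,h^\theta\}$ with $z^\theta\perp q$ and $(I-P_{\operatorname{span}\{q,z^\theta\}})r\perp l$ in $L^2([0,1])$, where $P_U$ denotes orthogonal projection onto $U$; fix one such $z^\theta$ for each $\theta$, once and for all. Put $r^\theta=(I-P_{\operatorname{span}\{q,z^\theta\}})r$ and $l^\theta=(I-P_{\operatorname{span}\{q,z^\theta\}})l$. Let $\boldsymbol{\theta}=(\theta_a)_{a\in\mathbf{a}}$ be a sequence in $(0,1)$. For $a\in\mathbf{a}$ let $\sigma_a$ be the affine function with $\sigma_a(a)=0$, $\sigma_a(a_+)=1$, and $z_a:=z^{\theta_a}\circ\sigma_a$. Let $\breve\Omega_a=\{q\circ\sigma_a,z_a\}$ if $a>0$, $\breve\Omega_0=\{l^{\theta_0}\circ\sigma_0,q\circ\sigma_0,z_0\}$, and for $a>0$ let $\bar\Omega_a=\{r^{\theta_{a_-}}\circ\sigma_{a_-}+l^{\theta_a}\circ\sigma_a\}$. Then $\Omega_{\mathbf{a},\boldsymbol{\theta}}$ is the union of all $\breve\Omega_a$ and $\bar\Omega_a$ (its elements may be normalized to have norm one, which does not affect $S(\Omega_{\mathbf{a},\boldsymbol{\theta}})$).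 *)

(* Defs.v *)
From HB Require Import structures.
From mathcomp Require Import all_boot all_order all_algebra.
From mathcomp Require Import all_classical all_reals all_analysis.

Set Implicit Arguments.
Unset Strict Implicit.
Unset Printing Implicit Defensive.

Import Order.TTheory GRing.Theory Num.Theory.
Import numFieldNormedType.Exports.

Local Open Scope classical_set_scope.
Local Open Scope ring_scope.

(* Lebesgue measure carried by [0, +oo[. The space L^2(R_+) is represented by
   the functions of [Lfun (leb_pos R) 2], read modulo a.e. equality for this
   measure, so that values at negative reals are irrelevant. *)
Definition leb_pos (R : realType) :
    {measure set (measurableTypeR R) -> \bar R} :=
  mrestr (@lebesgue_measure R) (measurable_itv `[0%R, +oo[).

Definition fspan (R : realType) (A : set (R -> R)) : set (R -> R) :=
  [set f | exists (n : nat) (c : 'I_n -> R) (g : 'I_n -> R -> R),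
     (forall i, A (g i)) /\ f = (fun x => \sum_(i < n) c i * g i x)].

(* The result is saturated under a.e. equality, as a subset of L^2 has to be. *)
Definition L2closure (R : realType) (mu : {measure set (measurableTypeR R) -> \bar R})
    (A : set (R -> R)) : set (R -> R) :=
  [set f | f \in Lfun mu 2%:E /\
     forall e : R, 0 < e ->
       exists2 g, A g & ('N[mu]_2%:E[EFin \o (f \- g)%R] < e%:E)%E].

Definition S_space (R : realType) (Omega : set (R -> R)) : set (R -> R) :=
  L2closure (leb_pos R) (fspan Omega).

Definition inner01 (R : realType) (f g : R -> R) : R :=
  \int[@lebesgue_measure R]_(x in `[0, 1]) (f x * g x).

(* Orthogonal projection onto U in L^2([0,1]). It is used only for spans of
   finitely many functions that are linearly independent in L^2([0,1]), for
   which the function p below exists and is unique. *)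
Definition oproj01 (R : realType) (U : set (R -> R)) (f : R -> R) : R -> R :=
  xget (cst 0)
    [set p | U p /\ forall u, U u -> inner01 (f \- p) u = 0].

Definition rfun (R : realType) (x : R) : R := if 0 <= x < 1 then x else 0.
Definition lfun (R : realType) (x : R) : R := if 0 <= x < 1 then 1 - x else 0.
Definition qfun (R : realType) (x : R) : R := 4 * rfun x * lfun x.

Definition q0 (R : realType) (theta x : R) : R := qfun (x / theta).
Definition q1 (R : realType) (theta x : R) : R :=
  qfun ((x - theta) / (1 - theta)).
Definition hfun (R : realType) (theta x : R) : R :=
  rfun (x / theta) + lfun ((x - theta) / (1 - theta)).

Definition res01 (R : realType) (z f : R -> R) : R -> R :=
  f \- oproj01 (fspan [set @qfun R; z]) f.

(* The functions of the first span vanish outside [0, 1[ and are piecewise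
   continuous, so z <> cst 0 amounts to z being nonzero in L^2([0,1]). *)
Definition admissible_z (R : realType) (theta : R) (z : R -> R) : Prop :=
  [/\ fspan [set q0 theta; q1 theta; hfun theta] z,
      z <> cst 0,
      inner01 z (@qfun R) = 0 &
      inner01 (res01 z (@rfun R)) (@lfun R) = 0].

(* Successor and predecessor in a knot sequence a of [0, +oo[: a has no cluster
   point, inf a = 0 is in a and sup a = +oo, so the default value 0 is never
   reached for knot_succ, nor for knot_pred at a positive knot. *)
Definition knot_succ (R : realType) (a : set R) (x : R) : R :=
  xget 0 [set y | [/\ a y, x < y & forall y', a y' -> x < y' -> y <= y']].

Definition knot_pred (R : realType) (a : set R) (x : R) : R :=
  xget 0 [set y | [/\ a y, y < x & forall y', a y' -> y' < x -> y' <= y]].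

Definition sigma (R : realType) (a : set R) (x t : R) : R :=
  (t - x) / (knot_succ a x - x).

Section Omega.
Variables (R : realType) (z : R -> R -> R) (a : set R) (theta : R -> R).

Definition r_at (x : R) : R -> R :=
  res01 (z (theta x)) (@rfun R) \o sigma a x.
Definition l_at (x : R) : R -> R :=
  res01 (z (theta x)) (@lfun R) \o sigma a x.
Definition q_at (x : R) : R -> R := @qfun R \o sigma a x.
Definition z_at (x : R) : R -> R := z (theta x) \o sigma a x.

(* All the knots are nonnegative, so x != 0 is x > 0. *)
Definition Omega_breve (x : R) : set (R -> R) :=
  if x == 0 then [set l_at x; q_at x; z_at x] else [set q_at x; z_at x].

Definition Omega_bar (x : R) : set (R -> R) :=
  if x == 0 then set0 else [set r_at (knot_pred a x) \+ l_at x].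

Definition Omega : set (R -> R) :=
  \bigcup_(x in a) (Omega_breve x `|` Omega_bar x).
End Omega.

Definition tau (R : realType) : R := (1 + Num.sqrt 5) / 2.

Definition tau_integers (R : realType) : set R :=
  [set x | 0 <= x /\ exists (n : nat) (eps : nat -> bool),
     x = \sum_(k < n.+1) (eps k)%:R * tau R ^+ k].

Definition tau_knots (R : realType) (k : int) : set R :=
  [set tau R ^ (- k) * x | x in @tau_integers R].

Definition Vspace (R : realType) (z : R -> R -> R) (k : int) : set (R -> R) :=
  S_space (Omega z (@tau_knots R k) (fun=> (tau R)^-1)).

(* Main.v *)
Require Import Defs.
From HB Require Import structures.
From mathcomp Require Import all_boot all_order all_algebra.
From mathcomp Require Import all_classical all_reals all_analysis.
From mathcomp Require Import measurable_realfun simple_functions measurable_fun_approximation ring lra.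

Set Implicit Arguments.
Unset Strict Implicit.
Unset Printing Implicit Defensive.

Import Order.TTheory GRing.Theory Num.Theory.
Import numFieldNormedType.Exports.

Local Open Scope classical_set_scope.
Local Open Scope ring_scope.

(* Up to the projections, which only subtract multiples of the bubbles q and z,
   V^k is spanned by the hat functions of a^k and by the functions q and z
   transported to its intervals. Multiplying the tau-integers by tau splits each
   long gap in the ratio 1 : tau^-1 and turns each short gap into a long one, so
   a coarse interval is either fine or cut at its relative point theta = tau^-1,
   which is the break point of z: the generators of V^k are finite combinations
   of those of V^(k+1). Density: sums of hats are ramps that approximate the
   indicators of half-lines, whose span is dense. Trivial intersection: on
   [0, theta tau^-k[ the elements of V^k are quadratic polynomials, whose L^2
   mass on a fixed [0, T] is a fraction O(T tau^k) of their total mass; let k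
   tend to -oo. *)

(** * Spans and two-scale relations *)

(** Adjacent digits 1 are allowed, so a [tau]-integer may have several expansions and its successor
    cannot be read off one of them. The tiling gets around this: its left end points are exactly the
    [tau]-integers, and neighbouring tiles are known by construction. The elements of V^k are only
    L^2 limits of finite combinations, so the polynomial estimate near 0 applies to an approximant
    [g] of [f] whose norm is bounded uniformly in k, and not to [f] itself. Its constant 3000 comes
    from a crude comparison of quadratic forms; what matters is that it does not depend on the
    scale. Half-lines are the test sets for density for two reasons: on [0, +oo[ a ramp differs from
    such an indicator only inside one interval of a^k, whose length tends to 0, and half-lines form
    a pi-system generating the Borel sets. *)

Section Span.
Variable R : realType.
Implicit Types (A B : set (R -> R)) (f g : R -> R) (c : R).

Lemma fspan_ind A (P : set (R -> R)) :
    P (cst 0) ->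
    (forall c f g, A f -> P g -> P (fun x => c * f x + g x)) ->
  fspan A `<=` P.
Proof.
move=> P0 PS _ [n [c [g [Ag ->]]]].
elim: n c g Ag => [|n IH] c g Ag.
  by under eq_fun do rewrite big_ord0; exact: P0.
under eq_fun do rewrite big_ord_recl.
by apply: PS => //; apply: IH => i; exact: Ag.
Qed.

Lemma fspan_step A c f g : A f -> fspan A g -> fspan A (fun x => c * f x + g x).
Proof.
move=> Af [n [d [h [Ah ->]]]].
exists n.+1, (fun i => oapp d c (unlift ord0 i)),
  (fun i => oapp h f (unlift ord0 i)); split.
  by move=> i; case: unliftP => [j _|_] //=; exact: Ah.
apply/funext => x; rewrite big_ord_recl unlift_none /=.
by congr (_ + _); apply: eq_bigr => i _; rewrite liftK.
Qed.

Lemma fspan0 A : fspan A (cst 0).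
Proof.
exists 0, (fun=> 0), (fun=> cst 0); split; first by case.
by apply/funext => x; rewrite big_ord0.
Qed.

Lemma fspan_gen A f : A f -> fspan A f.
Proof.
move=> Af; suff -> : f = (fun x => 1 * f x + cst 0 x).
  by apply: fspan_step => //; exact: fspan0.
by apply/funext => x; rewrite mul1r addr0.
Qed.

Lemma fspanZ A c f : fspan A f -> fspan A (fun x => c * f x).
Proof.
move: f; apply: fspan_ind.
  suff -> : (fun x : R => c * cst 0 x) = cst 0 by exact: fspan0.
  by apply/funext => x; rewrite mulr0.
move=> d f g Af IH.
suff -> : (fun x => c * (d * f x + g x)) = (fun x => (c * d) * f x + c * g x).
  exact: fspan_step.
by apply/funext => x; ring.
Qed.

Lemma fspanD A f g : fspan A f -> fspan A g -> fspan A (fun x => f x + g x).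
Proof.
move=> Af Ag; move: f Af; apply: fspan_ind.
  by under eq_fun do rewrite add0r.
move=> c f h Af IH.
by under eq_fun do rewrite -addrA; exact: fspan_step.
Qed.

Lemma fspanB A f g : fspan A f -> fspan A g -> fspan A (fun x => f x - g x).
Proof.
move=> Af /(fspanZ (-1)) Ag; have := fspanD Af Ag.
by under eq_fun do rewrite mulN1r.
Qed.

Lemma fspan_min A B : A `<=` fspan B -> fspan A `<=` fspan B.
Proof.
move=> AB; apply: fspan_ind; first exact: fspan0.
by move=> c f g Af Bg; apply: fspanD => //; apply: fspanZ; exact: AB.
Qed.

Lemma fspan2P f g h : fspan [set f; g] h ->
  exists c d, h = fun x => c * f x + d * g x.
Proof.
move: h; apply: fspan_ind.
  by exists 0, 0; apply/funext => x; rewrite !mul0r addr0.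
move=> c u v [->|->] [a [b ->]]; [exists (c + a), b|exists a, (c + b)];
  by apply/funext => x; ring.
Qed.

Lemma fspan3P f g h u : fspan [set f; g; h] u ->
  exists a b c, u = fun x => a * f x + b * g x + c * h x.
Proof.
move: u; apply: fspan_ind.
  by exists 0, 0, 0; apply/funext => x; rewrite !mul0r !addr0.
move=> e u v [[->|->]|->] [a [b [c ->]]];
  [exists (e + a), b, c|exists a, (e + b), c|exists a, b, (e + c)];
  by apply/funext => x; ring.
Qed.

(* The residual belongs to [f + span{q, z}] even when the projection is the
   default value of [xget]: that default, 0, lies in the span. *)
Lemma res01E (z f : R -> R) :
  exists c d, res01 z f = fun x => f x + c * qfun x + d * z x.
Proof.
have : fspan [set @qfun R; z] (oproj01 (fspan [set @qfun R; z]) f).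
  by rewrite /oproj01; case: xgetP => [p _ []//|_]; exact: fspan0.
move=> /fspan2P[c [d E]]; exists (- c), (- d).
by apply/funext => x; rewrite /res01 /= E; ring.
Qed.

End Span.

(** * The shapes r, l, q and their refinement at a relative point theta *)

Section Shapes.
Variable R : realType.
Implicit Types v t theta : R.

Lemma rfun_out v : ~~ (0 <= v < 1) -> rfun v = 0.
Proof. by rewrite /rfun => /negbTE ->. Qed.

Lemma lfun_out v : ~~ (0 <= v < 1) -> lfun v = 0.
Proof. by rewrite /lfun => /negbTE ->. Qed.

Lemma qfun_out v : ~~ (0 <= v < 1) -> qfun v = 0.
Proof. by rewrite /qfun => /rfun_out ->; rewrite mulr0 mul0r. Qed.

Lemma rfun_in v : 0 <= v < 1 -> rfun v = v.
Proof. by rewrite /rfun => ->. Qed.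

Lemma lfun_in v : 0 <= v < 1 -> lfun v = 1 - v.
Proof. by rewrite /lfun => ->. Qed.

Lemma qfun_in v : 0 <= v < 1 -> qfun v = 4 * v * (1 - v).
Proof. by rewrite /qfun => v01; rewrite rfun_in// lfun_in. Qed.

Lemma itv_left theta v : 0 < theta ->
  (0 <= v / theta < 1) = (0 <= v < theta).
Proof. by move=> t0; rewrite pmulr_lge0 ?invr_gt0// ltr_pdivrMr// mul1r. Qed.

Lemma itv_right theta v : theta < 1 ->
  (0 <= (v - theta) / (1 - theta) < 1) = (theta <= v < 1).
Proof.
by move=> t1; rewrite itv_left ?subr_gt0// subr_ge0 ltrD2r.
Qed.

(** Interpolation at the break point: [hfun theta] is the hat peaked at [theta], so its coefficient
    is the value there, [4 * theta * (1 - theta)] for q, [1 - theta] for l and [theta] for r. For q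
    the remainder on each half is a parabola vanishing at both ends with leading coefficient -4,
    that is, a bubble scaled by the square of the length of that half. *)
Lemma two_scale theta v : 0 < theta < 1 ->
  [/\ qfun v = 4 * theta * (1 - theta) * hfun theta v + theta ^+ 2 * q0 theta v
        + (1 - theta) ^+ 2 * q1 theta v,
      lfun v = lfun (v / theta) + (1 - theta) * hfun theta v &
      rfun v = theta * hfun theta v + rfun ((v - theta) / (1 - theta))].
Proof.
move=> /andP[t0 t1]; rewrite /hfun /q0 /q1.
have tn0 : theta != 0 by rewrite gt_eqF.
have tn1 : 1 - theta != 0 by rewrite gt_eqF// subr_gt0.
have [v0|v0] := ltP v 0.
  have e1 : ~~ (0 <= v < 1) by rewrite leNgt v0.
  have e2 : ~~ (0 <= v / theta < 1) by rewrite itv_left// leNgt v0.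
  have e3 : ~~ (0 <= (v - theta) / (1 - theta) < 1).
    by rewrite itv_right// leNgt (lt_trans v0).
  by rewrite !(qfun_out e1, rfun_out e1, lfun_out e1, qfun_out e2, rfun_out e2,
    lfun_out e2, qfun_out e3, rfun_out e3, lfun_out e3); split; ring.
have [vt|tv] := ltP v theta.
  have e1 : 0 <= v < 1 by rewrite v0 (lt_trans vt).
  have e2 : 0 <= v / theta < 1 by rewrite itv_left// v0.
  have e3 : ~~ (0 <= (v - theta) / (1 - theta) < 1).
    by rewrite itv_right// leNgt vt.
  by rewrite !(qfun_in e1, rfun_in e1, lfun_in e1, qfun_in e2, rfun_in e2,
    lfun_in e2, qfun_out e3, rfun_out e3, lfun_out e3); split; field.
have e2 : ~~ (0 <= v / theta < 1) by rewrite itv_left// v0 /= -leNgt.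
have [v1|v1] := ltP v 1.
  have e1 : 0 <= v < 1 by rewrite v0.
  have e3 : 0 <= (v - theta) / (1 - theta) < 1 by rewrite itv_right// tv.
  by rewrite !(qfun_in e1, rfun_in e1, lfun_in e1, qfun_out e2, rfun_out e2,
    lfun_out e2, qfun_in e3, rfun_in e3, lfun_in e3); split; field.
have e1 : ~~ (0 <= v < 1) by rewrite v0 /= -leNgt.
have e3 : ~~ (0 <= (v - theta) / (1 - theta) < 1).
  by rewrite itv_right// tv /= -leNgt.
by rewrite !(qfun_out e1, rfun_out e1, lfun_out e1, qfun_out e2, rfun_out e2,
  lfun_out e2, qfun_out e3, rfun_out e3, lfun_out e3); split; ring.
Qed.

End Shapes.

(** * Abstract knot sequences and their generators without projections *)

Section Knots.
Variable R : realType.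
Implicit Types (a b : set R) (p s x theta : R).

(** A relation between neighbours, so that the default value in [knot_succ] and [knot_pred] never
    has to be discussed again. *)
Definition consecutive a p s :=
  [/\ a p, a s, p < s & forall y, a y -> p < y -> s <= y].

Lemma knot_succE a p s : consecutive a p s -> knot_succ a p = s.
Proof.
move=> [ap as_ ps gap]; apply: xget_unique => // y [ay py gapy].
by apply/eqP; rewrite eq_le gap// gapy.
Qed.

Lemma knot_predE a p s : consecutive a p s -> knot_pred a s = p.
Proof.
move=> [ap as_ ps gap]; apply: xget_unique; first split => // y ay ys.
  by rewrite leNgt; apply/negP => /(gap _ ay); rewrite leNgt ys.
move=> y [ay ys gapy]; apply/eqP; rewrite eq_le gapy// andbT.
by rewrite leNgt; apply/negP => /(gap _ ay); rewrite leNgt ys.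
Qed.

Definition knot_seq a := [/\ a 0, forall x, a x -> 0 <= x,
  forall x, a x -> exists s, consecutive a x s &
  forall x, a x -> x != 0 -> exists p, consecutive a p x].

Definition affine p s : R -> R := fun t => (t - p) / (s - p).

Definition hat p x s (t : R) : R := rfun (affine p x t) + lfun (affine x s t).

Section Generators.
Variables (z : R -> R -> R) (a : set R) (theta : R).
Hypothesis ka : knot_seq a.
Local Notation Om := (Omega z a (fun=> theta)).

Lemma fspan_q p s : consecutive a p s -> fspan Om (fun t => qfun (affine p s t)).
Proof.
move=> aps; apply: fspan_gen; exists p; first by case: aps.
left; rewrite /Omega_breve.
suff -> : (fun t => qfun (affine p s t)) = q_at a p by case: ifP => _; [left; right|left].
by apply/funext => t; rewrite /q_at /= /sigma (knot_succE aps).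
Qed.

Lemma fspan_z p s : consecutive a p s ->
  fspan Om (fun t => z theta (affine p s t)).
Proof.
move=> aps; apply: fspan_gen; exists p; first by case: aps.
left; rewrite /Omega_breve.
suff -> : (fun t => z theta (affine p s t)) = z_at z a (fun=> theta) p by case: ifP => _; right.
by apply/funext => t; rewrite /z_at /= /sigma (knot_succE aps).
Qed.

Lemma fspan_l0 s : consecutive a 0 s -> fspan Om (fun t => lfun (affine 0 s t)).
Proof.
move=> a0s; have [c [d lE]] := res01E (z theta) (@lfun R).
have : fspan Om (l_at z a (fun=> theta) 0).
  apply: fspan_gen; exists 0; first by case: a0s.
  by left; rewrite /Omega_breve eqxx; left; left.
move=> /fspanB-/(_ _ (fspanD (fspanZ c (fspan_q a0s)) (fspanZ d (fspan_z a0s)))).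
congr (fspan _ _); apply/funext => t.
by rewrite /l_at /= lE /sigma (knot_succE a0s) /affine; ring.
Qed.

Lemma fspan_hat p x s : consecutive a p x -> consecutive a x s ->
  fspan Om (hat p x s).
Proof.
move=> apx axs; have [c [d lE]] := res01E (z theta) (@lfun R).
have [c' [d' rE]] := res01E (z theta) (@rfun R).
have [_ a0 _ _] := ka.
have x0 : x != 0.
  by case: apx => /a0 p0 _ px _; rewrite gt_eqF// (le_lt_trans p0).
have : fspan Om (r_at z a (fun=> theta) (knot_pred a x) \+ l_at z a (fun=> theta) x).
  apply: fspan_gen; exists x; first by case: axs.
  by right; rewrite /Omega_bar (negbTE x0).
move=> /fspanB-/(_ _ (fspanD
  (fspanD (fspanZ c (fspan_q axs)) (fspanZ d (fspan_z axs)))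
  (fspanD (fspanZ c' (fspan_q apx)) (fspanZ d' (fspan_z apx))))).
congr (fspan _ _); apply/funext => t; rewrite /hat /r_at /l_at /= lE rE /sigma.
by rewrite (knot_predE apx) (knot_succE apx) (knot_succE axs) /affine; ring.
Qed.

(** Converse to the preceding lemmas: the projected generators are combinations of the unprojected
    ones. Refinement, measurability and the polynomial shape near 0 are all reduced through it to
    these four simple families. *)
Lemma Omega_sub_fspan (A : set (R -> R)) :
    (forall p s, consecutive a p s -> fspan A (fun t => qfun (affine p s t))) ->
    (forall p s, consecutive a p s -> fspan A (fun t => z theta (affine p s t))) ->
    (forall s, consecutive a 0 s -> fspan A (fun t => lfun (affine 0 s t))) ->
    (forall p x s, consecutive a p x -> consecutive a x s -> fspan A (hat p x s)) ->
  Om `<=` fspan A.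
Proof.
move=> Aq Az Al Ah f [x ax].
have [a0 age0 asucc apred] := ka.
have [s axs] := asucc x ax.
have [c [d lE]] := res01E (z theta) (@lfun R).
have [c' [d' rE]] := res01E (z theta) (@rfun R).
have Aqx : fspan A (q_at a x).
  have := Aq _ _ axs; congr (fspan _ _).
  by apply/funext => t; rewrite /q_at /= /sigma (knot_succE axs).
have Azx : fspan A (z_at z a (fun=> theta) x).
  have := Az _ _ axs; congr (fspan _ _).
  by apply/funext => t; rewrite /z_at /= /sigma (knot_succE axs).
rewrite /Omega_breve /Omega_bar.
have [x0|x0] := eqVneq x 0; last first.
  have [p apx] := apred x ax x0.
  move=> [[->|->]//|->].
  have := fspanD (Ah _ _ _ apx axs) (fspanD
    (fspanD (fspanZ c (Aq _ _ axs)) (fspanZ d (Az _ _ axs)))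
    (fspanD (fspanZ c' (Aq _ _ apx)) (fspanZ d' (Az _ _ apx)))).
  congr (fspan _ _); apply/funext => t; rewrite /hat /r_at /l_at /= lE rE /sigma.
  by rewrite (knot_predE apx) (knot_succE apx) (knot_succE axs) /affine; ring.
move=> [[[->|->//]|->//]|[]].
rewrite x0 in axs *.
have := fspanD (Al _ axs)
    (fspanD (fspanZ c (Aq _ _ axs)) (fspanZ d (Az _ _ axs))).
congr (fspan _ _); apply/funext => t; rewrite /l_at /= lE /sigma.
by rewrite (knot_succE axs) /affine; ring.
Qed.

End Generators.

Definition split_pt theta p s := p + theta * (s - p).

Definition refines theta a b := forall p s, consecutive a p s ->
  consecutive b p s \/
  consecutive b p (split_pt theta p s) /\ consecutive b (split_pt theta p s) s.

(** * Inclusion of spans under refinement of knots *)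

Section Refinement.
Variables (z : R -> R -> R) (a b : set R) (theta : R).
Hypotheses (ka : knot_seq a) (kb : knot_seq b) (t01 : 0 < theta < 1).
Hypothesis zt : fspan [set q0 theta; q1 theta; hfun theta] (z theta).
Hypothesis ab : refines theta a b.
Local Notation Om := (Omega z b (fun=> theta)).

Lemma affine_left p s t : p < s ->
  affine p (split_pt theta p s) t = affine p s t / theta.
Proof.
move=> ps; have [t0 t1] := andP t01; rewrite /affine /split_pt.
have h : p + theta * (s - p) - p = theta * (s - p) by ring.
by rewrite h; field; rewrite !gt_eqF ?subr_gt0.
Qed.

Lemma affine_right p s t : p < s ->
  affine (split_pt theta p s) s t = (affine p s t - theta) / (1 - theta).
Proof.
move=> ps; have [t0 t1] := andP t01; rewrite /affine /split_pt.
have h : s - (p + theta * (s - p)) = (s - p) * (1 - theta) by ring.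
by rewrite h; field; rewrite !gt_eqF ?subr_gt0.
Qed.

Lemma hat_mid p s t : p < s ->
  hat p (split_pt theta p s) s t = hfun theta (affine p s t).
Proof. by move=> ps; rewrite /hat affine_left// affine_right. Qed.

Lemma refine_q p s : consecutive a p s -> fspan Om (fun t => qfun (affine p s t)).
Proof.
move=> /[dup] aps [_ _ ps _]; have [bps|[b1 b2]] := ab aps.
  exact: fspan_q.
have := fspanD (fspanD
  (fspanZ (4 * theta * (1 - theta)) (fspan_hat z theta kb b1 b2))
  (fspanZ (theta ^+ 2) (fspan_q z theta b1)))
  (fspanZ ((1 - theta) ^+ 2) (fspan_q z theta b2)).
congr (fspan _ _); apply/funext => t.
by have [-> _ _] := two_scale (affine p s t) t01;
  rewrite hat_mid// affine_left// affine_right.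
Qed.

Lemma refine_z p s : consecutive a p s ->
  fspan Om (fun t => z theta (affine p s t)).
Proof.
move=> /[dup] aps [_ _ ps _]; have [bps|[b1 b2]] := ab aps.
  exact: fspan_z.
(* Transported to a split interval, [q0], [q1] and [hfun] are the two fine bubbles and the fine hat
   at the splitting point. *)
have [c [d [e zE]]] := fspan3P zt.
have := fspanD (fspanD (fspanZ c (fspan_q z theta b1))
  (fspanZ d (fspan_q z theta b2))) (fspanZ e (fspan_hat z theta kb b1 b2)).
congr (fspan _ _); apply/funext => t.
by rewrite zE hat_mid// affine_left// affine_right.
Qed.

(* Both parts of a coarse hat function refine to a fine half hat ending at the
   same knot, up to a multiple of the hat at the splitting point. *)
Lemma refine_l x s : consecutive a x s -> exists s' g,
  [/\ consecutive b x s', fspan Om g &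
      forall t, lfun (affine x s t) = lfun (affine x s' t) + g t].
Proof.
move=> /[dup] axs [_ _ xs _]; have [bxs|[b1 b2]] := ab axs.
  exists s, (cst 0); split => //; first exact: fspan0.
  by move=> t; rewrite addr0.
exists (split_pt theta x s), (fun t => (1 - theta) * hat x (split_pt theta x s) s t).
split => //; first exact/fspanZ/fspan_hat.
move=> t; have [_ -> _] := two_scale (affine x s t) t01.
by rewrite hat_mid// affine_left.
Qed.

Lemma refine_r p x : consecutive a p x -> exists p' g,
  [/\ consecutive b p' x, fspan Om g &
      forall t, rfun (affine p x t) = rfun (affine p' x t) + g t].
Proof.
move=> /[dup] apx [_ _ px _]; have [bpx|[b1 b2]] := ab apx.
  exists p, (cst 0); split => //; first exact: fspan0.
  by move=> t; rewrite addr0.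
exists (split_pt theta p x), (fun t => theta * hat p (split_pt theta p x) x t).
split => //; first exact/fspanZ/fspan_hat.
move=> t; have [_ _ ->] := two_scale (affine p x t) t01.
by rewrite hat_mid// affine_right// addrC.
Qed.

Lemma fspan_Omega_refine : fspan (Omega z a (fun=> theta)) `<=` fspan Om.
Proof.
apply: fspan_min; apply: Omega_sub_fspan => //.
- exact: refine_q.
- exact: refine_z.
- move=> s /refine_l[s' [g [b0 Bg E]]].
  have := fspanD (fspan_l0 z theta b0) Bg.
  by congr (fspan _ _); apply/funext => t; rewrite E.
- move=> p x s /refine_r[p' [g [bp Bg E]]] /refine_l[s' [g' [bs Bg' E']]].
  (* The two remaining fine half hats meet at [x] and form one fine hat; neither of them alone need
     be in the span. *)
  have := fspanD (fspan_hat z theta kb bp bs) (fspanD Bg Bg').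
  by congr (fspan _ _); apply/funext => t; rewrite /hat E E'; ring.
Qed.

End Refinement.
End Knots.

(** * The tiling by tau-integers *)

Section TauIntegers.
Variable R : realType.
Local Notation tau := (tau R).
Local Notation Z := (@tau_integers R).
Implicit Types (x y c u p : R) (t : bool).

Lemma tau_sqr : tau ^+ 2 = tau + 1.
Proof.
have h : Num.sqrt (5 : R) ^+ 2 = 5 by rewrite sqr_sqrtr.
by rewrite /tau; nra.
Qed.

Lemma tau_bounds : 3 / 2 <= tau <= 2.
Proof.
have s0 : 0 <= Num.sqrt (5 : R) by exact: sqrtr_ge0.
have h : Num.sqrt (5 : R) ^+ 2 = 5 by rewrite sqr_sqrtr.
by rewrite /tau; apply/andP; split; nra.
Qed.

Lemma tau_gt0 : 0 < tau. Proof. by have /andP[? _] := tau_bounds; lra. Qed.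

Lemma tau_gt1 : 1 < tau. Proof. by have /andP[? _] := tau_bounds; lra. Qed.

Lemma tauV : tau^-1 = tau - 1.
Proof.
apply: (mulfI (lt0r_neq0 tau_gt0)); rewrite divff ?(lt0r_neq0 tau_gt0)//.
by have := tau_sqr; rewrite expr2 => e; lra.
Qed.

Lemma tau_pow_unbounded c : exists n, c < tau ^+ n.
Proof.
(* Bernoulli's inequality, with [tau - 1 >= 1 / 2]. *)
have h n : 1 + n%:R / 2 <= tau ^+ n.
  elim: n => [|n IH]; first by rewrite mul0r addr0.
  have /andP[t1 _] := tau_bounds; rewrite exprS -natr1.
  have : 0 <= n%:R :> R by [].
  by nra.
exists (Num.bound (2 * c)); apply: lt_le_trans (h _).
have := archi_boundP (normr_ge0 (2 * c)).
have := ler_norm (2 * c) => h1.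
have [c0|c0] := leP 0 (2 * c); last first.
  by move=> _; have : 0 <= (Num.bound (2 * c))%:R :> R by []; lra.
by rewrite ger0_norm//; lra.
Qed.

Lemma tau_integers_horner x t : Z x -> Z (tau * x + t%:R).
Proof.
move=> [x0 [n [eps xE]]]; split.
  by rewrite addr_ge0// mulr_ge0// ltW// tau_gt0.
exists n.+1, (fun k => if k is k'.+1 then eps k' else t).
rewrite big_ord_recl /= expr0 mulr1 addrC xE mulr_sumr; congr (_ + _).
by apply: eq_bigr => i _; rewrite /bump /= exprS mulrCA.
Qed.

(** Horner's scheme: digits are consumed from the top one down, each step multiplying by [tau] and
    adding the next digit. No condition on adjacent digits enters. *)
Lemma tau_integers_ind (P : set R) :
    P 0 -> (forall x t, Z x -> P x -> P (tau * x + t%:R)) ->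
  Z `<=` P.
Proof.
move=> P0 PS x [_ [n [eps ->]]].
have : forall m (e : nat -> bool), Z (\sum_(k < m) (e k)%:R * tau ^+ k) /\
    P (\sum_(k < m) (e k)%:R * tau ^+ k).
  elim=> [|m IH] e.
    rewrite big_ord0; split => //; split => //.
    by exists 0, (fun=> false); rewrite big_ord1 mul0r.
  rewrite big_ord_recl expr0 mulr1 addrC.
  under eq_bigr do rewrite /= /bump exprS mulrCA /=.
  rewrite -mulr_sumr; have [Zm Pm] := IH (fun k => e k.+1).
  by split; [exact: tau_integers_horner|exact: PS].
by move=> /(_ n.+1 eps) [].
Qed.

Lemma tau_integers0 : Z 0.
Proof.
split=> //; exists 0, (fun=> false).
by rewrite big_ord1 mul0r.
Qed.

Definition gap t : R := if t then 1 else tau^-1.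

(* [tile n x t] : [x, x + gap t[ is one of the intervals into which [0, tau^n[
   is cut by the substitution that inflates by tau, then splits the inflated
   long gap tau into 1 + tau^-1; the inflated short gap is 1. *)
Fixpoint tile n x t : Prop :=
  if n isn't m.+1 then x = 0 /\ t
  else if t then exists y s, tile m y s /\ x = tau * y
  else exists y, tile m y true /\ x = tau * y + 1.

Lemma gap_bounds t : tau^-1 <= gap t <= 1.
Proof.
by have := tau_bounds; case: t => /andP[h1 h2]; rewrite /gap ?tauV; apply/andP; split; lra.
Qed.

Lemma gap_gt0 t : 0 < gap t.
Proof.
by have /andP[h _] := gap_bounds t; rewrite (lt_le_trans _ h)// invr_gt0 tau_gt0.
Qed.

Lemma tau_gap t : tau * gap t = if t then tau else 1.
Proof. by case: t; rewrite /gap ?mulr1// divff// lt0r_neq0// tau_gt0. Qed.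

(** The initial tile [0, 1[ is its own first child, so each level extends the previous one to the
    right. *)
Lemma tileS n x t : tile n x t -> tile n.+1 x t.
Proof.
elim: n x t => [|n IH] x t.
  by move=> /= [-> ->]; exists 0, true; rewrite mulr0.
case: t => [[y [s [nys ->]]]|[y [ny ->]]]; [exists y, s|exists y];
  by split => //; exact: IH.
Qed.

Lemma tile_le n m x t : (n <= m)%N -> tile n x t -> tile m x t.
Proof.
by move=> /subnK <-; elim: (m - n)%N => // k IH /IH; rewrite addSn; exact: tileS.
Qed.

Lemma tile_tau_integers n x t : tile n x t -> Z x /\ Z (x + gap t).
Proof.
have Z1 : Z 1.
  by have := tau_integers_horner true tau_integers0; rewrite mulr0 add0r.
elim: n x t => [|n IH] x t /=.
  by move=> [-> ->]; rewrite add0r; split => //; exact: tau_integers0.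
have tZ y : Z y -> Z (tau * y).
  by move=> /(tau_integers_horner false); rewrite addr0.
case: t => [[y [s [/IH[Zy _] ->]]]|[y [/IH[Zy Zyg] ->]]].
  by split; [exact: tZ|exact: (tau_integers_horner true)].
split; first exact: (tau_integers_horner true).
have := tZ _ Zyg; congr (Z _).
by rewrite mulrDr tau_gap /gap tauV; ring.
Qed.

(** The right neighbour is the short sibling when the tile is the first child of a long one, and
    otherwise the first child of the parent's right neighbour. The level rises by one because the
    last tile of level [n] has its neighbour outside [0, tau^n[. *)
Lemma tile_next n x t : tile n x t -> exists s, tile n.+1 (x + gap t) s.
Proof.
elim: n x t => [|n IH] x t.
  move=> [-> ->]; exists false, 0; split => //.
  by rewrite add0r mulr0 add0r.
case: t => [[y [s [nys ->]]]|[y [ny ->]]]; last first.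
  have [s hs] := IH _ _ ny; exists true, (y + 1), s; split => //.
  by rewrite /gap tauV; ring.
case: s nys => nys.
  by exists false, y; split => //; exact: tileS.
have [s hs] := IH _ _ nys; exists true, (y + tau^-1), s; split => //.
by rewrite mulrDr divff// lt0r_neq0// tau_gt0.
Qed.

(** Appending the digit 0 leads to the first child, and the digit 1 to the second child of a long
    tile. For a short tile, [tau * x + 1 = tau * (x + tau^-1)] is the first child of the next tile:
    this is the carry [tau ^+ 2 = tau + 1]. *)
Lemma tau_integers_tile : Z `<=` [set x | exists n t, tile n x t].
Proof.
apply: tau_integers_ind; first by exists 0, true.
move=> x [] _ [n [t]]; last first.
  by move=> nx; exists n.+1, true, x, t; rewrite addr0.
case: t => nx; first by exists n.+1, false, x.
have [s xs] := tile_next nx; exists n.+2, true, (x + tau^-1), s; split => //.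
by rewrite mulrDr divff// lt0r_neq0// tau_gt0.
Qed.

Lemma tile_prev n x t : tile n x t ->
  x = 0 \/ exists m y s, tile m y s /\ x = y + gap s.
Proof.
elim: n x t => [|n IH] x t; first by move=> [-> _]; left.
case: t => [[y [s [nys ->]]]|[y [ny ->]]]; last first.
  by right; exists n.+1, (tau * y), true; split => //; exists y, true.
have [->|[m [w [[|] [mw ->]]]]] := IH _ _ nys; first by left; rewrite mulr0.
- right; exists m.+1, (tau * w + 1), false; split; first by exists w.
  by rewrite /gap tauV; ring.
- right; exists m.+1, (tau * w), true; split; first by exists w, false.
  by rewrite mulrDr tau_gap.
Qed.

(** Inflation preserves the order of disjoint parents, and each tile lies inside its inflated
    parent; under a common parent only the long child and the short one after it have to be
    compared. *)
Lemma tile_disjoint n x t y s : tile n x t -> tile n y s ->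
  [\/ x = y /\ t = s, x + gap t <= y | y + gap s <= x].
Proof.
have t0 := tau_gt0.
have parent m v r : tile m.+1 v r -> exists w q, [/\ tile m w q,
    tau * w <= v, v + gap r <= tau * (w + gap q) &
    if r then v = tau * w else q /\ v = tau * w + 1].
  have := tau_gt1 => t1.
  case: r => [[w [q [mw ->]]]|[w [mw ->]]]; [exists w, q|exists w, true]; split => //.
  - by rewrite mulrDr lerD2l tau_gap [gap _]/=; case: (q) => //; rewrite ltW.
  - by rewrite lerDl.
  - by rewrite mulrDr tau_gap -addrA lerD2l /gap tauV addrCA subrr addr0.
elim: n x t y s => [|n IH] x t y s.
  by move=> [-> ->] [-> ->]; constructor 1.
move=> /parent[x' [t' [nx x'x xx' hx]]] /parent[y' [s' [ny y'y yy' hy]]].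
have [[ex et]|xy|yx] := IH _ _ _ _ nx ny.
- rewrite -ex -et in hy; case: t s hx hy {xx' yy'} => [] [] hx hy.
  + by constructor 1; rewrite hx hy.
  + by constructor 2; rewrite hx (hy.2).
  + by constructor 3; rewrite hy (hx.2).
  + by constructor 1; rewrite (hy.2) (hx.2).
- by constructor 2; rewrite (le_trans xx')// (le_trans _ y'y)// ler_pM2l.
- by constructor 3; rewrite (le_trans yy')// (le_trans _ x'x)// ler_pM2l.
Qed.

Lemma tile_cover n c : 0 <= c < tau ^+ n ->
  exists x t, tile n x t /\ x <= c < x + gap t.
Proof.
have t0 := tau_gt0.
elim: n c => [|n IH] c /andP[c0 cn].
  by exists 0, true; rewrite add0r c0.
have [|x [t [nx /andP[xc cx]]]] := IH (c / tau).
  by rewrite divr_ge0 ?(ltW t0)//= ltr_pdivrMr// -exprSr.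
rewrite ler_pdivlMr// mulrC in xc.
rewrite ltr_pdivrMr// mulrC mulrDr tau_gap in cx.
have [cx1|cx1] := ltP c (tau * x + 1).
  by exists (tau * x), true; rewrite xc cx1; split => //; exists x, t.
case: t nx cx => nx cx; last by rewrite ltNge cx1 in cx.
exists (tau * x + 1), false; split; first by exists x.
by rewrite cx1/= /gap tauV (lt_le_trans cx)// -addrA [1 + _]addrC subrK.
Qed.

Lemma tile_consecutive n x t : tile n x t -> consecutive Z x (x + gap t).
Proof.
move=> nx; have [Zx Zx'] := tile_tau_integers nx; split => //.
  by rewrite ltrDl gap_gt0.
move=> y /tau_integers_tile[m [s my]] xy.
(* Every [tau]-integer [y] is the left end of a tile; at a common level, disjointness keeps it out
   of the interior of the given tile. *)
have [[e _]|//|] := tile_disjoint (tile_le (leq_maxl n m) nx)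
  (tile_le (leq_maxr n m) my).
- by rewrite e ltxx in xy.
- by move=> h; have := gap_gt0 s; lra.
Qed.

(** For [u = tau ^ (- k)] this is [tau_knots k] by conversion; an arbitrary positive [u] keeps
    integer exponents out of the geometry. *)
Definition scaled u : set R := [set u * x | x in Z].

Section Scaled.
Variable u : R.
Hypothesis u0 : 0 < u.

Lemma tile_scaled n x t : tile n x t -> consecutive (scaled u) (u * x) (u * (x + gap t)).
Proof.
move=> /tile_consecutive[Zx Zx' xx gp]; split; [by exists x|by exists (x + gap t)| |].
  by rewrite ltr_pM2l.
by move=> _ [y Zy <-]; rewrite ltr_pM2l// ler_pM2l// => /gp; exact.
Qed.

Lemma scaled_tile p s : consecutive (scaled u) p s ->
  exists n x t, [/\ tile n x t, p = u * x & s = u * (x + gap t)].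
Proof.
move=> cps; have [[x /tau_integers_tile[n [t nx]] xp] _ _ _] := cps.
exists n, x, t; split => //.
by rewrite -(knot_succE cps) -xp; apply/esym; rewrite (knot_succE (tile_scaled nx)).
Qed.

Lemma scaled_knot_seq : knot_seq (scaled u).
Proof.
split; first by exists 0; rewrite ?mulr0//; exact: tau_integers0.
- by move=> _ [x [x0 _] <-]; rewrite mulr_ge0// ltW.
- move=> _ [x /tau_integers_tile[n [t nx]] <-].
  by exists (u * (x + gap t)); apply: tile_scaled nx.
- move=> _ [x /tau_integers_tile[n [t nx]] <-] ux0.
  have [x0|[m [y [s [my ->]]]]] := tile_prev nx.
    by rewrite x0 mulr0 eqxx in ux0.
  by exists (u * y); exact: tile_scaled my.
Qed.

Lemma scaled_gap p s : consecutive (scaled u) p s -> u / tau <= s - p <= u.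
Proof.
move=> /scaled_tile[n [x [t [_ -> ->]]]].
rewrite -mulrBr addrAC subrr add0r ler_pM2l//.
by have /andP[-> h] := gap_bounds t; rewrite ger_pMr.
Qed.

Lemma scaled_cover c : 0 <= c -> exists p s,
  consecutive (scaled u) p s /\ p <= c < s.
Proof.
move=> c0; have [n cn] := tau_pow_unbounded (c / u).
have [|x [t [nx]]] := @tile_cover n (c / u).
  by rewrite divr_ge0// ltW.
rewrite ler_pdivlMr// ltr_pdivrMr// ![_ * u]mulrC => h.
by exists (u * x), (u * (x + gap t)); split => //; exact: tile_scaled nx.
Qed.

Lemma scaled_first : consecutive (scaled u) 0 u.
Proof.
have := @tile_scaled 0 0 true.
by rewrite mulr0 add0r mulr1; exact.
Qed.

End Scaled.

Lemma scaled_refines u : 0 < u -> refines tau^-1 (scaled (u * tau)) (scaled u).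
Proof.
move=> u0.
have t0 := tau_gt0; have tn0 := lt0r_neq0 t0; have ut0 : 0 < u * tau by rewrite mulr_gt0.
move=> _ _ /(scaled_tile ut0)[n [x [t [nx -> ->]]]].
have lE : u * tau * x = u * (tau * x) by rewrite mulrA.
have rE : u * tau * (x + gap t) = u * (tau * x + if t then tau else 1).
  by rewrite -tau_gap -mulrDr mulrA.
(* Before scaling by [u], the inflated tile has length [tau * gap t], so its point of relative
   position [tau^-1] is at distance [gap t] from the left end. For a long tile this is where its
   long child ends. *)
have mE : split_pt tau^-1 (u * tau * x) (u * tau * (x + gap t)) =
    u * (tau * x + gap t) by rewrite /split_pt; field.
have : tile n.+1 (tau * x) true by exists x, t.
move/(tile_scaled u0) => c1; rewrite mE lE rE.
case: t nx {rE mE} => nx; last by left.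
right; split => //.
have : tile n.+1 (tau * x + 1) false by exists x.
by move/(tile_scaled u0); congr (consecutive _ _ _); rewrite /gap tauV; ring.
Qed.

End TauIntegers.

(** * Square norms and closures in L^2 *)

Section SquareNorm.
Context d (T : measurableType d) (R : realType).
Variable mu : {measure set T -> \bar R}.
Implicit Types (f g h : T -> R) (e c : R).

(** The squared L^2 norm, with values in the extended reals: the estimates need neither roots nor
    prior integrability. *)
Definition sqnorm f : \bar R := (\int[mu]_x ((f x) ^+ 2)%:E)%E.

Lemma measurable_sqr (D : set T) f : measurable_fun D f ->
  measurable_fun D (fun x => (f x ^+ 2)%:E : \bar R).
Proof. by move=> mf; apply/measurable_EFinP; exact: measurable_funX. Qed.

Lemma sqnorm_ge0 f : (0 <= sqnorm f)%E.
Proof. by apply: integral_ge0 => x _; rewrite lee_fin sqr_ge0. Qed.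

Lemma Lnorm2E f : ('N[mu]_2%:E[EFin \o f] = sqnorm f `^ 2^-1)%E.
Proof.
rewrite unlock /= /sqnorm; congr (_ `^ _)%E; apply: eq_integral => x _ /=.
by rewrite powR_mulrn// -normrX ger0_norm// sqr_ge0.
Qed.

Lemma Lnorm2_lt f e : 0 < e ->
  ('N[mu]_2%:E[EFin \o f] < e%:E)%E = (sqnorm f < (e ^+ 2)%:E)%E.
Proof.
move=> e0; rewrite Lnorm2E; have := sqnorm_ge0 f.
case: (sqnorm f) => [r| |]//=; last first.
  by rewrite invr_eq0 pnatr_eq0.
rewrite lee_fin !lte_fin => r0; rewrite powR12_sqrt//.
by rewrite -[e in LHS]ger0_norm ?ltW// -sqrtr_sqr ltr_sqrt// exprn_gt0.
Qed.

Lemma Lnorm2_lty f : ('N[mu]_2%:E[EFin \o f] < +oo)%E = (sqnorm f < +oo)%E.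
Proof.
rewrite Lnorm2E; have := sqnorm_ge0 f.
case: (sqnorm f) => [r| |]//= _; last by rewrite invr_eq0 pnatr_eq0.
by rewrite !ltry.
Qed.

Lemma Lfun2P f : f \in Lfun mu 2%:E <->
  measurable_fun setT f /\ (sqnorm f < +oo)%E.
Proof.
rewrite -Lnorm2_lty; split.
  by rewrite inE => /andP[]; rewrite !inE.
by move=> [mf lf]; rewrite inE; apply/andP; rewrite !inE.
Qed.

Lemma le_sqnorm f g : measurable_fun setT f -> measurable_fun setT g ->
  (forall x, f x ^+ 2 <= g x ^+ 2) -> (sqnorm f <= sqnorm g)%E.
Proof.
move=> mf mg fg; apply: ge0_le_integral => //.
- by move=> x _; rewrite lee_fin sqr_ge0.
- exact: measurable_sqr.
- exact: measurable_sqr.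
- by move=> x _; rewrite lee_fin.
Qed.

Lemma sqnormZ c f : measurable_fun setT f ->
  sqnorm (fun x => c * f x) = ((c ^+ 2)%:E * sqnorm f)%E.
Proof.
move=> mf; rewrite /sqnorm.
under eq_integral do rewrite exprMn EFinM.
rewrite ge0_integralZl_EFin ?sqr_ge0//.
- by move=> x _; rewrite lee_fin sqr_ge0.
- exact: measurable_sqr.
Qed.

(** Substitute for the triangle inequality, from [(f x - g x) ^+ 2 >= 0]. Its factor 2 is why errors
    are later split into quarters. *)
Lemma sqnormD f g : measurable_fun setT f -> measurable_fun setT g ->
  (sqnorm (fun x => f x + g x)%R <= 2%:E * sqnorm f + 2%:E * sqnorm g)%E.
Proof.
move=> mf mg; rewrite /sqnorm -!ge0_integralZl_EFin//; first last.
- exact: measurable_sqr.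
- by move=> x _; rewrite lee_fin sqr_ge0.
- exact: measurable_sqr.
- by move=> x _; rewrite lee_fin sqr_ge0.
rewrite -ge0_integralD//; first last.
- by apply: measurable_funeM; exact: measurable_sqr.
- by move=> x _; rewrite mule_ge0// lee_fin sqr_ge0.
- by apply: measurable_funeM; exact: measurable_sqr.
- by move=> x _; rewrite mule_ge0// lee_fin sqr_ge0.
apply: ge0_le_integral => //.
- by move=> x _; rewrite lee_fin sqr_ge0.
- by apply: measurable_sqr; exact: measurable_funD.
- by apply: emeasurable_funD; apply: measurable_funeM; exact: measurable_sqr.
- by move=> x _; rewrite -!EFinM -EFinD lee_fin; have := sqr_ge0 (f x - g x); lra.
Qed.

Lemma sqnorm_dominated (f_ : (T -> R)^nat) f g :
    (forall n, measurable_fun setT (f_ n)) -> measurable_fun setT f ->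
    mu.-integrable setT (EFin \o g) ->
    (forall n x, (f_ n x - f x) ^+ 2 <= g x) ->
    (forall x, f_ ^~ x @ \oo --> f x) ->
  forall e, 0 < e -> exists n, (sqnorm (fun x => f x - f_ n x)%R < e%:E)%E.
Proof.
move=> mf_ mf ig fg ff e e0.
have mfd n : measurable_fun setT (fun x => f_ n x - f x).
  by apply: measurable_funB.
have [|||||_ _] := @dominated_convergence _ _ _ mu setT measurableT
  (fun n x => ((f_ n x - f x) ^+ 2)%:E) (cst 0%E) (EFin \o g).
- by move=> n; exact: measurable_sqr.
- exact: measurable_cst.
- apply/nearW => x _; apply/fine_cvgP; split; first exact: nearW.
  rewrite /comp /=.
  have /cvgr0_norm_lt : (fun n => f_ n x - f x) @ \oo --> (0 : R).
    by rewrite -(subrr (f x)); apply: cvgB => //; exact: cvg_cst.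
  move=> h; apply/cvgr0Pnorm_lt => eps eps0.
  near=> n; rewrite normrX -(@sqr_sqrtr _ eps) ?ltW//.
  rewrite ltr_pXn2r ?nnegrE ?sqrtr_ge0//.
  by near: n; apply: h; rewrite sqrtr_gt0.
- exact: ig.
- by apply/nearW => x n _; rewrite gee0_abs ?lee_fin ?sqr_ge0//= fg.
rewrite integral0 => /fine_cvgP[fin cv].
have [N _ hN] : \forall n \near \oo,
    (\int[mu]_x ((f_ n x - f x) ^+ 2)%:E < e%:E)%E.
  move/cvgr0_norm_lt/(_ _ e0): cv => cv.
  near=> n.
  have fn : (\int[mu]_x ((f_ n x - f x) ^+ 2)%:E \is a fin_num)%E by near: n.
  rewrite -(fineK fn) lte_fin (le_lt_trans (ler_norm _))//.
  by near: n.
exists N; have := hN N (leqnn _).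
rewrite /sqnorm; apply: le_lt_trans; rewrite le_eqVlt; apply/orP; left; apply/eqP.
by apply: eq_integral => x _; rewrite -sqrrN opprB.
Unshelve. all: by end_near.
Qed.

End SquareNorm.

(** * Closed linear subspaces as L^2 closures *)

Section Closure.
Variable R : realType.
Variable mu : {measure set (measurableTypeR R) -> \bar R}.
Implicit Types (A : set (R -> R)) (f g : R -> R) (c e : R) (S : set R).

Lemma L2closureP A f : L2closure mu A f <->
  f \in Lfun mu 2%:E /\
  forall e, 0 < e -> exists2 g, A g & (sqnorm mu (fun x => f x - g x)%R < e%:E)%E.
Proof.
split=> -[Lf h]; split => // e e0.
  have [|g Ag] := h (Num.sqrt e); first by rewrite sqrtr_gt0.
  by rewrite Lnorm2_lt ?sqrtr_gt0// sqr_sqrtr ?ltW//; exists g.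
have [|g Ag gf] := h (e ^+ 2); first by rewrite exprn_gt0.
by exists g => //; rewrite Lnorm2_lt.
Qed.

Lemma sub_L2closure A f : f \in Lfun mu 2%:E -> A f -> L2closure mu A f.
Proof.
move=> Lf Af; apply/L2closureP; split => // e e0; exists f => //.
rewrite /sqnorm; under eq_integral do rewrite subrr expr0n.
by rewrite integral0 lte_fin.
Qed.

Lemma L2closure_mono A B : A `<=` B -> L2closure mu A `<=` L2closure mu B.
Proof.
move=> AB f [Lf h]; split => // e e0; have [g Ag gf] := h _ e0.
by exists g => //; exact: AB.
Qed.

Lemma Lfun2_lin c f g : f \in Lfun mu 2%:E -> g \in Lfun mu 2%:E ->
  (fun x => c * f x + g x) \in Lfun mu 2%:E.
Proof.
move=> /Lfun2P[mf sf] /Lfun2P[mg sg]; apply/Lfun2P.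
have mcf : measurable_fun setT (fun x => c * f x) by exact: measurable_funM.
split; first exact: measurable_funD.
apply: (le_lt_trans (sqnormD mu mcf mg)); rewrite sqnormZ//.
apply: lte_add_pinfty; rewrite lte_mul_pinfty ?lee_fin//.
by rewrite lte_mul_pinfty ?lee_fin ?sqr_ge0.
Qed.

Section Linear.
Variable A : set (R -> R).
Hypothesis mA : forall f, A f -> measurable_fun setT f.

(** Idempotence of the closure: an approximant of an approximant, with a quarter of the error for
    each. *)
Lemma L2closure_lim f : f \in Lfun mu 2%:E ->
    (forall e, 0 < e -> exists2 g, L2closure mu A g &
      (sqnorm mu (fun x => f x - g x)%R < e%:E)%E) ->
  L2closure mu A f.
Proof.
move=> Lf h; apply/L2closureP; split => // e e0.
have [|g /L2closureP[/Lfun2P[mg _] hg] fg] := h (e / 4); first by rewrite divr_gt0.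
have [|k Ak gk] := hg (e / 4); first by rewrite divr_gt0.
exists k => //; have /Lfun2P[mf _] := Lf; have mk := mA Ak.
have -> : (fun x => f x - k x) = (fun x => (f x - g x) + (g x - k x)).
  by apply/funext => x; ring.
have mfg : measurable_fun setT (fun x => f x - g x) by exact: measurable_funB.
have mgk : measurable_fun setT (fun x => g x - k x) by exact: measurable_funB.
apply: (le_lt_trans (sqnormD mu mfg mgk)).
have -> : e%:E = (2%:E * (e / 4)%:E + 2%:E * (e / 4)%:E)%E.
  by rewrite -!EFinM -EFinD; congr EFin; lra.
by apply: lteD; rewrite lte_pmul2l.
Qed.

Lemma L2closure_ae_eq f g : L2closure mu A f -> measurable_fun setT g ->
  sqnorm mu (fun x => g x - f x)%R = 0%E -> L2closure mu A g.
Proof.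
move=> Cf mg gf0; apply: L2closure_lim; last first.
  by move=> e e0; exists f => //; rewrite gf0 lte_fin.
have /L2closureP[Lf _] := Cf; have /Lfun2P[mf sf] := Lf.
apply/Lfun2P; split => //.
have -> : g = (fun x => (g x - f x) + f x) by apply/funext => x; rewrite subrK.
have mgf : measurable_fun setT (fun x => g x - f x) by exact: measurable_funB.
apply: (le_lt_trans (sqnormD mu mgf mf)).
by rewrite gf0 mule0 add0e lte_mul_pinfty// lee_fin.
Qed.

Hypothesis A0 : A (cst 0).
Hypothesis linA : forall c f g, A f -> A g -> A (fun x => c * f x + g x).

Lemma L2closure0 : L2closure mu A (cst 0).
Proof.
apply: sub_L2closure => //; apply/Lfun2P; split; first exact: measurable_cst.
by rewrite /sqnorm; under eq_integral do rewrite expr0n; rewrite integral0 ltry.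
Qed.

Lemma L2closure_lin c f g : L2closure mu A f -> L2closure mu A g ->
  L2closure mu A (fun x => c * f x + g x).
Proof.
move=> /L2closureP[Lf hf] /L2closureP[Lg hg]; apply/L2closureP; split.
  exact: Lfun2_lin.
move=> e e0; have c0 : 0 < c ^+ 2 + 1 by have := sqr_ge0 c; lra.
(* [c ^+ 2 + 1] dominates [c ^+ 2] and stays positive when [c = 0]. *)
have [|f' Af' ff'] := hf (e / 4 / (c ^+ 2 + 1)); first by rewrite !divr_gt0.
have [|g' Ag' gg'] := hg (e / 4); first by rewrite divr_gt0.
exists (fun x => c * f' x + g' x); first exact: linA.
have -> : (fun x => c * f x + g x - (c * f' x + g' x)) =
    (fun x => c * (f x - f' x) + (g x - g' x)).
  by apply/funext => x; ring.
have /Lfun2P[mf _] := Lf; have /Lfun2P[mg _] := Lg.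
have mf' := mA Af'; have mg' := mA Ag'.
have mff : measurable_fun setT (fun x => f x - f' x) by exact: measurable_funB.
have mgg : measurable_fun setT (fun x => g x - g' x) by exact: measurable_funB.
have mcff : measurable_fun setT (fun x => c * (f x - f' x)) by exact: measurable_funM.
apply: (le_lt_trans (sqnormD mu mcff mgg)); rewrite sqnormZ//.
have -> : e%:E = (2%:E * (e / 4)%:E + 2%:E * (e / 4)%:E)%E.
  by rewrite -!EFinM -EFinD; congr EFin; lra.
apply: lteD; rewrite lte_pmul2l//.
apply: (@le_lt_trans _ _ ((c ^+ 2 + 1)%:E * sqnorm mu (fun x => f x - f' x)%R)%E).
  by rewrite lee_wpmul2r ?sqnorm_ge0// lee_fin lerDl.
move: ff'; rewrite -(@lte_pmul2l _ (c ^+ 2 + 1)%:E)// => /lt_le_trans; apply.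
by rewrite -EFinM lee_fin mulrC divfK// gt_eqF.
Qed.

Lemma L2closure_sum n (c : 'I_n -> R) (h : 'I_n -> R -> R) :
  (forall i, L2closure mu A (h i)) ->
  L2closure mu A (fun x => \sum_(i < n) c i * h i x).
Proof.
elim: n c h => [|n IH] c h Ch.
  by under eq_fun do rewrite big_ord0; exact: L2closure0.
under eq_fun do rewrite big_ord_recl.
by apply: L2closure_lin; [exact: Ch|apply: IH => i; exact: Ch].
Qed.

Lemma L2closure_dominated (f_ : (R -> R)^nat) f g :
    (forall n, L2closure mu A (f_ n)) -> f \in Lfun mu 2%:E ->
    mu.-integrable setT (EFin \o g) ->
    (forall n x, (f_ n x - f x) ^+ 2 <= g x) ->
    (forall x, f_ ^~ x @ \oo --> f x) ->
  L2closure mu A f.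
Proof.
move=> Cf Lf ig fg ff; apply: L2closure_lim => // e e0.
have mf_ n : measurable_fun setT (f_ n).
  by have /L2closureP[/Lfun2P[]] := Cf n.
have /Lfun2P[mf _] := Lf.
by have [n hn] := @sqnorm_dominated _ (measurableTypeR R) R mu f_ f g mf_ mf ig fg ff e e0; exists (f_ n).
Qed.

End Linear.
End Closure.

(** * A linear class whose closure contains the indicators of half-lines is dense *)

Section Density.
Variable R : realType.
Variable mu : {measure set (measurableTypeR R) -> \bar R}.
Implicit Types (A : set (R -> R)) (f g : R -> R) (c e : R) (S : set R).

Variable A : set (R -> R).
Hypothesis mA : forall f, A f -> measurable_fun setT f.
Hypothesis A0 : A (cst 0).
Hypothesis linA : forall c f g, A f -> A g -> A (fun x => c * f x + g x).
Hypothesis Arays : forall c, L2closure mu A \1_(`]-oo, c[).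

Local Notation C := (L2closure mu A).

Let ray c : set R := `]-oo, c[.

Let sqr_indic S : (fun x : R => (\1_S x : R) ^+ 2) = \1_S.
Proof. by apply/funext => x; rewrite indicE; case: (_ \in _); rewrite ?expr1n ?expr0n. Qed.

Let ray_integrable c : mu.-integrable setT (EFin \o \1_(ray c)).
Proof.
have /L2closureP[Lf _] := Arays c.
by have := Lfun2_integrable_sqr Lf; rewrite sqr_indic.
Qed.

Let indic_Lfun S c : measurable S -> S `<=` ray c -> \1_S \in Lfun mu 2%:E.
Proof.
move=> mS Sc; apply/Lfun2P; split; first exact: measurable_indic.
have /L2closureP[/Lfun2P[mr fr] _] := Arays c.
apply: le_lt_trans fr; apply: le_sqnorm => // x.
rewrite !indicE; case: (boolP (x \in S)) => xS; last by rewrite expr0n sqr_ge0.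
by rewrite mem_set//; apply: Sc; rewrite inE in xS.
Qed.

(** Dynkin induction on [S]. Cutting by a fixed ray keeps all indicators square integrable,
    complements included: the complement of [B] gives the indicator of the ray minus that of [B] cut
    by it, and disjoint unions pass to the limit under the domination by [\1_(ray c)]. *)
Lemma L2closure_indic_ray S c : measurable S -> C \1_(S `&` ray c).
Proof.
move=> mS; have mr : measurable (ray c) by exact: measurable_itv.
pose P S := C \1_(S `&` ray c).
suff h : forall B, <<s @RGenInftyO.G R>> B -> P B.
  by apply: h; rewrite -[<<s _ >>]/((@RGenInftyO.G R).-sigma.-measurable) -RGenInftyO.measurableE.
apply: (@dynkin_induction _ (measurableTypeR R)).
- exact: RGenInftyO.measurableE.
- move=> _ _ [x ->] [y ->]; exists (Num.min x y); apply/seteqP; split => t /=.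
    by rewrite !in_itv/= lt_min => -[-> ->].
  by rewrite !in_itv/= lt_min => /andP.
- by rewrite /P setTI; exact: Arays.
- move=> _ [x ->]; rewrite /P; have := Arays (Num.min x c).
  congr (L2closure _ _ \1__); rewrite /ray; apply/seteqP; split => t /=.
    by rewrite !in_itv/= lt_min => /andP.
  by rewrite !in_itv/= lt_min => -[-> ->].
- move=> B mB PB; have := L2closure_lin mA linA (-1) PB (Arays c).
  congr (L2closure _ _ _); apply/funext => x.
  rewrite !indicE !in_setI in_setC -/(ray c).
  by case: (x \in B); case: (x \in ray c) => /=; ring.
- move=> F mF tF PF; rewrite /P.
  pose f_ n : R -> R := \1_(\bigcup_(k < n) F k `&` ray c).
  apply: (@L2closure_dominated _ mu _ mA f_ _ (\1_(ray c))) => //.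
  + move=> n; elim: n => [|n IH]; rewrite /f_.
      rewrite bigcup_mkord big_ord0 set0I indic0.
      exact: L2closure0.
    have := L2closure_lin mA linA 1 (PF n) IH; rewrite /f_.
    congr (L2closure _ _ _); apply/funext => x.
    rewrite bigcup_mkord [in RHS]bigcup_mkord big_ord_recr/= -bigcup_mkord.
    rewrite !indicE !in_setI in_setU.
    case: (boolP (x \in F n)) => xn; last by rewrite orbF mulr0 add0r.
    have -> : (x \in \bigcup_(k < n) F k) = false.
      apply/negbTE/negP; rewrite !inE in xn * => -[k /= kn Fk].
      have kE : k = n by apply: tF => //; exists x.
      by rewrite kE ltnn in kn.
    by rewrite /= addr0 mul1r.
  + apply: (@indic_Lfun _ c); last by move=> x [].
    apply: measurableI; last exact: mr.
    by apply: bigcup_measurable => k _; exact: mF.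
  + move=> n x; rewrite /f_ !indicE !in_setI.
    case: (x \in ray c) => /=; rewrite ?andbF ?andbT ?subrr ?expr0n//.
    by do 2 case: (x \in _); rewrite ?subrr ?subr0 ?sub0r ?sqrrN ?expr0n ?expr1n.
  + move=> x; rewrite /f_ indicE in_setI.
    have [xF|xF] := boolP (x \in \bigcup_k F k).
      have := xF; rewrite inE => -[k _ Fkx].
      apply: cvg_near_cst; exists k.+1 => // n /= kn.
      rewrite indicE in_setI (_ : x \in \bigcup_(k < n) F k)//.
      by rewrite inE; exists k.
    rewrite /=; apply: cvg_near_cst; apply: nearW => n.
    rewrite indicE in_setI (_ : x \in \bigcup_(k < n) F k = false)//.
    apply/negbTE; apply: contra xF; rewrite !inE => -[k _ Fkx].
    by exists k.
Qed.

Import HBNNSimple.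

Lemma L2closure_nnsfun (h : {nnsfun (measurableTypeR R) >-> R}) c :
  C (fun x => h x * \1_(ray c) x).
Proof.
pose s := finmap.enum_fset (fset_set (range h)).
have := @L2closure_sum _ mu _ mA A0 linA (size s) (fun i => s`_i)
  (fun i => \1_(h @^-1` [set s`_i] `&` ray c)).
move=> /(_ (fun i => L2closure_indic_ray c (measurable_sfunP h (measurable_set1 _)))).
congr (L2closure _ _ _); apply/funext => x.
rewrite (fimfunEord h x) mulr_suml; apply: eq_bigr => i _.
by rewrite indicI mulrA.
Qed.

(** Simple functions increasing to [f] are cut off at [n] so that the previous lemma applies. Since
    the cut functions stay between 0 and [f], their squared errors are dominated by the integrable
    [f ^+ 2]. *)
Lemma L2closure_ge0 f : f \in Lfun mu 2%:E -> (forall x, 0 <= f x) -> C f.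
Proof.
move=> Lf f0; have /Lfun2P[mf sf] := Lf.
have mEf : measurable_fun setT (EFin \o f : measurableTypeR R -> \bar R).
  exact/measurable_EFinP.
pose h := nnsfun_approx measurableT mEf.
have cvh x : (fun n => h n x) @ \oo --> f x.
  have : EFin \o h^~ x @ \oo --> (f x)%:E.
    by apply: (@cvg_nnsfun_approx _ _ _ _ measurableT _ mEf) => // t _; rewrite lee_fin.
  by move/fine_cvgP => [].
have hf n x : h n x <= f x.
  have cvx := cvh x.
  rewrite -(cvg_lim _ cvx)//; apply: (@nondecreasing_cvgn_le _ (h ^~ x)).
    by move=> i j ij; have /lefP := nd_nnsfun_approx measurableT mEf ij; exact.
  by apply/cvg_ex; exists (f x).
pose f_ n x := h n x * \1_(ray n%:R) x.
apply: (@L2closure_dominated _ mu _ mA f_ _ (fun x => f x ^+ 2)) => //.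
- by move=> n; exact: L2closure_nnsfun.
- exact: Lfun2_integrable_sqr.
- move=> n x; have h0 : 0 <= h n x by exact: fun_ge0.
  have := hf n x; rewrite /f_ indicE.
  by case: (_ \in _); rewrite ?mulr1 ?mulr0 => hfx; nra.
- move=> x; rewrite -[f x]mulr1; apply: cvgM; first exact: cvh.
  apply: cvg_near_cst; exists (Num.bound `|x|) => // n /= xn.
  rewrite indicE mem_set// /ray /= in_itv/=.
  rewrite (le_lt_trans (ler_norm x))// (lt_le_trans (archi_boundP _))//.
  by rewrite ler_nat.
Qed.

Lemma L2closure_full f : f \in Lfun mu 2%:E -> C f.
Proof.
move=> Lf; have /Lfun2P[mf sf] := Lf.
have part g : (g = fun x => Num.max (f x) 0) \/ (g = fun x => Num.max (- f x) 0) -> C g.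
  move=> gE; apply: L2closure_ge0; last first.
    by move=> x; case: gE => ->; rewrite le_max lexx orbT.
  have mg : measurable_fun setT g.
    case: gE => ->; apply: measurable_maxr => //; exact: measurable_funN.
  apply/Lfun2P; split => //; apply: le_lt_trans sf; apply: le_sqnorm => // x.
  case: gE => ->; case: (leP _ 0) => _; rewrite ?expr0n ?sqr_ge0//.
  by rewrite sqrrN.
have := L2closure_lin mA linA (-1) (part _ (or_intror erefl)) (part _ (or_introl erefl)).
congr (L2closure _ _ _); apply/funext => x.
by case: (leP (f x) 0) => fx; case: (leP (- f x) 0) => fx'; lra.
Qed.

End Density.

(** * Integrals against a restricted measure *)

Section Restriction.
Context d (T : measurableType d) (R : realType).
Variable mu : {measure set T -> \bar R}.

Lemma ge0_integral_mrestr (D : set T) (mD : measurable D) (f : T -> \bar R) :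
    measurable_fun setT f -> (forall x, 0 <= f x)%E ->
  (\int[mrestr mu mD]_x f x = \int[mu]_(x in D) f x)%E.
Proof.
move=> mf f0; have mD0 : mrestr mu mD (~` D) = 0%E.
  by rewrite /mrestr setICl measure0.
rewrite (ge0_negligible_integral _ _ mf _ mD0)//; last exact: measurableC.
rewrite setTD setCK; apply: eq_measure_integral => A mA AD.
by rewrite /= /mrestr (setIidl AD).
Qed.

End Restriction.

(** * Lebesgue measure on the half-line and the mass of quadratic polynomials *)

Section HalfLine.
Variable R : realType.
Local Notation leb := (@lebesgue_measure R).
Local Notation mu := (leb_pos R).
Implicit Types (f g : R -> R) (L A B C : R) (S : set R).

Lemma measurable_sqrR f : measurable_fun setT f ->
  measurable_fun setT (fun x : measurableTypeR R => (f x ^+ 2)%:E).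
Proof. by move=> mf; exact: measurable_sqr. Qed.

Lemma sqnorm_leb_pos f : measurable_fun setT f ->
  sqnorm mu f = (\int[leb]_(x in `[0%R, +oo[) (f x ^+ 2)%:E)%E.
Proof.
move=> mf; rewrite /sqnorm ge0_integral_mrestr//; first exact: measurable_sqrR.
by move=> x; rewrite lee_fin sqr_ge0.
Qed.

(** Mass on a segment is expressed by another measure, so that the general facts on [sqnorm] apply
    to it unchanged. *)
Definition leb_seg L : {measure set (measurableTypeR R) -> \bar R} :=
  mrestr leb (measurable_itv `[0%R, L]).

Lemma sqnorm_leb_seg L f : measurable_fun setT f ->
  sqnorm (leb_seg L) f = (\int[leb]_(x in `[0%R, L]) (f x ^+ 2)%:E)%E.
Proof.
move=> mf; rewrite /sqnorm ge0_integral_mrestr//; first exact: measurable_sqrR.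
by move=> x; rewrite lee_fin sqr_ge0.
Qed.

Lemma sqnorm_leb_seg_le L f : measurable_fun setT f ->
  (sqnorm (leb_seg L) f <= sqnorm mu f)%E.
Proof.
move=> mf; rewrite sqnorm_leb_seg// sqnorm_leb_pos//.
apply: ge0_subset_integral => //.
- by apply: measurable_funTS; exact: measurable_sqrR.
- by move=> x _; rewrite lee_fin sqr_ge0.
- by move=> x /=; rewrite !in_itv/= andbT => /andP[].
Qed.

Lemma sqnorm_leb_pos_indic f S : measurable_fun setT f -> measurable S ->
  (forall x, f x ^+ 2 <= \1_S x) -> (sqnorm mu f <= leb (S `&` `[0%R, +oo[))%E.
Proof.
move=> mf mS fS; apply: (@le_trans _ _ (\int[mu]_x (\1_S x)%:E)%E).
  apply: ge0_le_integral => //.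
  - by move=> x _; rewrite lee_fin sqr_ge0.
  - exact: measurable_sqrR.
  - exact/measurable_EFinP.
  - by move=> x _; rewrite lee_fin.
by rewrite integral_indic// setIT.
Qed.

Definition quad A B C (t : R) : R := A + B * t + C * t ^+ 2.

(* The integral of [quad A B C ^+ 2] over [0, 1], as a sum of squares. *)
Definition quad_energy A B C : R :=
  (A + B / 2 + C / 3) ^+ 2 + (B + C) ^+ 2 / 12 + C ^+ 2 / 180.

Lemma integral_quad_sqr A B C L : 0 < L ->
  (\int[leb]_(x in `[0%R, L]) (quad A B C x ^+ 2)%:E =
   (L * quad_energy A (B * L) (C * L ^+ 2))%:E)%E.
Proof.
move=> L0.
(* An antiderivative of the expanded square of [quad A B C]. *)
pose F : {poly R} := (A ^+ 2) *: 'X + (A * B) *: 'X^2 +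
  ((B ^+ 2 + 2 * A * C) / 3) *: 'X^3 + (B * C / 2) *: 'X^4 + (C ^+ 2 / 5) *: 'X^5.
have qE : (fun x => quad A B C x ^+ 2) = horner F^`().
  apply/funext => x; rewrite /F !(derivD, derivZ, derivXn, derivX) !hornerE /quad /=.
  by field.
rewrite (@continuous_FTC2 _ (fun x => quad A B C x ^+ 2) (horner F) 0 L)//; last 3 first.
- by rewrite qE; apply: continuous_subspaceT => x; exact: continuous_horner.
- split; first by move=> x _; exact: derivable_horner.
  + by apply: cvg_at_right_filter; exact: continuous_horner.
  + by apply: cvg_at_left_filter; exact: continuous_horner.
- by move=> x _; rewrite -derivE -qE.
by rewrite -EFinB; congr EFin; rewrite /F !(hornerD, hornerZ, hornerXn, hornerX) /quad_energy; field.
Qed.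

(** The energy is comparable to [A ^+ 2 + B ^+ 2 + C ^+ 2], which can only decrease under the
    shrinking. The constant is the product of 3 (upper comparison) and 1000 (lower comparison);
    neither is optimal. *)
Lemma quad_energy_shrink A B C r : 0 <= r <= 1 ->
  quad_energy A (B * r) (C * r ^+ 2) <= 3000 * quad_energy A B C.
Proof.
move=> /andP[r0 r1].
have r2 : r ^+ 2 <= 1 by rewrite expr_le1.
have up (a b c : R) : quad_energy a b c <= 3 * (a ^+ 2 + b ^+ 2 + c ^+ 2).
  rewrite /quad_energy.
  have := sqr_ge0 (a - b / 2); have := sqr_ge0 (a - c / 3).
  have := sqr_ge0 (b / 2 - c / 3); have := sqr_ge0 (b - c).
  have := sqr_ge0 a; have := sqr_ge0 b; have := sqr_ge0 c.
  by lra.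
have shrink (b s : R) : s ^+ 2 <= 1 -> (b * s) ^+ 2 <= b ^+ 2.
  by move=> s1; rewrite exprMn -[leRHS]mulr1; apply: ler_wpM2l => //; exact: sqr_ge0.
have low : A ^+ 2 + B ^+ 2 + C ^+ 2 <= 1000 * quad_energy A B C.
  rewrite /quad_energy; set a := A + B / 2 + C / 3; set b := B + C.
  have -> : A = a - (b - C) / 2 - C / 3 by rewrite /a /b; field.
  have -> : B = b - C by rewrite /b; ring.
  have := sqr_ge0 (a + b); have := sqr_ge0 (a - b); have := sqr_ge0 (a - C).
  have := sqr_ge0 (b - C); have := sqr_ge0 (b + C); have := sqr_ge0 (a + C).
  have := sqr_ge0 a; have := sqr_ge0 b; have := sqr_ge0 C.
  by lra.
have := up A (B * r) (C * r ^+ 2).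
have := shrink B r r2.
have := shrink C (r ^+ 2) (exprn_ile1 _ (sqr_ge0 r) r2).
by lra.
Qed.

(** Rescaled to [0, 1], the two masses are [T] and [L] times energies whose coefficients differ by
    powers of [T / L]. The energies are comparable, which leaves the ratio of the lengths. *)
Lemma sqnorm_seg_quad f A B C T L : measurable_fun setT f -> 0 < T <= L ->
    (forall t, 0 <= t <= L -> f t = quad A B C t) ->
  (sqnorm (leb_seg T) f <= (3000 * (T / L))%:E * sqnorm (leb_seg L) f)%E.
Proof.
move=> mf /andP[T0 TL] fq; have L0 : 0 < L by exact: lt_le_trans TL.
have E M : 0 < M -> M <= L ->
    sqnorm (leb_seg M) f = (M * quad_energy A (B * M) (C * M ^+ 2))%:E.
  move=> M0 ML; rewrite sqnorm_leb_seg// -integral_quad_sqr//.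
  apply: eq_integral => x; rewrite inE/= in_itv/= => /andP[x0 xM].
  by rewrite fq// x0 (le_trans xM).
rewrite !E// -EFinM lee_fin.
have Ln0 : L != 0 by rewrite gt_eqF.
have -> : 3000 * (T / L) * (L * quad_energy A (B * L) (C * L ^+ 2)) =
    T * (3000 * quad_energy A (B * L) (C * L ^+ 2)) by field.
rewrite ler_pM2l//.
have -> : B * T = B * L * (T / L) by field.
have -> : C * T ^+ 2 = C * L ^+ 2 * (T / L) ^+ 2 by field.
apply: quad_energy_shrink.
by rewrite divr_ge0 ?(ltW T0) ?(ltW L0)//= ler_pdivrMr// mul1r.
Qed.

End HalfLine.

(** * The multiresolution analysis *)

Section OmegaProperties.
Variables (R : realType) (z : R -> R -> R) (a : set R) (theta : R).
Hypothesis ka : knot_seq a.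
Hypothesis zt : fspan [set q0 theta; q1 theta; hfun theta] (z theta).
Local Notation Om := (Omega z a (fun=> theta)).
Implicit Types (p s x t d : R).

Lemma measurable_rfun : measurable_fun setT (@rfun R).
Proof.
suff -> : @rfun R = (fun x => x * \1_(`[0, 1[) x) by exact: measurable_funM.
apply/funext => x; rewrite /rfun indicE.
have -> : (x \in (`[0, 1[%classic : set R)) = (0 <= x < 1) by rewrite mem_setE in_itv.
by case: ifP => _; rewrite ?mulr1 ?mulr0.
Qed.

Lemma measurable_lfun : measurable_fun setT (@lfun R).
Proof.
suff -> : @lfun R = (fun x => (1 - x) * \1_(`[0, 1[) x).
  by apply: measurable_funM => //; exact: measurable_funB.
apply/funext => x; rewrite /lfun indicE.
have -> : (x \in (`[0, 1[%classic : set R)) = (0 <= x < 1) by rewrite mem_setE in_itv.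
by case: ifP => _; rewrite ?mulr1 ?mulr0.
Qed.

Lemma measurable_qfun : measurable_fun setT (@qfun R).
Proof.
apply: measurable_funM; last exact: measurable_lfun.
by apply: measurable_funM => //; exact: measurable_rfun.
Qed.

Lemma measurable_affine_comp (f : R -> R) p c : measurable_fun setT f ->
  measurable_fun setT (fun t => f ((t - p) / c)).
Proof.
move=> mf; apply: (measurableT_comp mf).
by apply: measurable_funM => //; exact: measurable_funB.
Qed.

Lemma measurable_z : measurable_fun setT (z theta).
Proof.
have [c [d [e ->]]] := fspan3P zt.
have mq0 : measurable_fun setT (q0 theta).
  have := @measurable_affine_comp _ 0 theta measurable_qfun.
  by under eq_fun do rewrite subr0.
have mq1 : measurable_fun setT (q1 theta) by exact: (measurable_affine_comp _ _ measurable_qfun).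
have mh : measurable_fun setT (hfun theta).
  apply: measurable_funD; last exact: (measurable_affine_comp _ _ measurable_lfun).
  have := @measurable_affine_comp _ 0 theta measurable_rfun.
  by under eq_fun do rewrite subr0.
by apply: measurable_funD; [apply: measurable_funD|]; apply: measurable_funM.
Qed.

Lemma measurable_fspan (A : set (R -> R)) :
    (forall f, A f -> measurable_fun setT f) ->
  forall f, fspan A f -> measurable_fun setT f.
Proof.
move=> mA; apply: fspan_ind; first exact: measurable_cst.
move=> c f g /mA mf mg; apply: measurable_funD => //; exact: measurable_funM.
Qed.

Lemma measurable_fspan_Omega f : fspan Om f -> measurable_fun setT f.
Proof.
move: f; apply: measurable_fspan => f /(Omega_sub_fspan ka (A := [set f | measurable_fun setT f])) H.
apply: (@measurable_fspan [set f | measurable_fun setT f]) => //; apply: H.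
- by move=> p s _; apply: fspan_gen; exact: (measurable_affine_comp _ _ measurable_qfun).
- by move=> p s _; apply: fspan_gen; exact: (measurable_affine_comp _ _ measurable_z).
- by move=> s _; apply: fspan_gen; exact: (measurable_affine_comp _ _ measurable_lfun).
- move=> p x s _ _; apply: fspan_gen; apply: measurable_funD.
  + exact: (measurable_affine_comp _ _ measurable_rfun).
  + exact: (measurable_affine_comp _ _ measurable_lfun).
Qed.

Lemma affine_in p s t : p < s -> (0 <= affine p s t < 1) = (p <= t < s).
Proof. by move=> ps; rewrite itv_left ?subr_gt0// subr_ge0 ltrD2r. Qed.

(* Partial sum of the hat functions: they add up to 1 on [0, p[. *)
Definition ramp p s t : R := (0 <= t < p)%R%:R + lfun (affine p s t).

(** If [q] precedes [p], then [ramp p s] is [ramp q p] plus the hat peaked at [p]. The lower bound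
    [d] on the gaps makes this descent to 0 finite: [n] with [p <= d * n%:R] drops by one at each
    step. *)
Lemma fspan_ramp d : 0 < d -> (forall p s, consecutive a p s -> d <= s - p) ->
  forall p s, consecutive a p s -> fspan Om (ramp p s).
Proof.
have [a0 a_ge0 asucc apred] := ka.
move=> d0 gapd; suff H n p s : p <= d * n%:R -> consecutive a p s -> fspan Om (ramp p s).
  move=> p s; apply: (H (Num.bound `|p / d|)).
  rewrite mulrC -ler_pdivrMr// (le_trans (ler_norm _))// ltW//.
  exact: archi_boundP.
have base q : consecutive a 0 q -> fspan Om (ramp 0 q).
  move=> /(fspan_l0 z theta); congr (fspan _ _); apply/funext => t.
  by rewrite /ramp; case: (leP 0 t) => // t0; rewrite ?add0r// ltNge t0 add0r.
elim: n p s => [|n IH] p s pn aps.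
  have [/a_ge0 p0 _ _ _] := aps.
  suff p00 : p = 0 by rewrite p00 in aps *; exact: base.
  by apply/eqP; rewrite eq_le p0 andbT; rewrite mulr0 in pn.
have [p0|p0] := eqVneq p 0; first by rewrite p0 in aps *; exact: base.
have [ap _ ps _] := aps.
have [q aqp] := apred p ap p0; have [/a_ge0 q0 _ qp _] := aqp.
have rq : fspan Om (ramp q p).
  apply: (IH _ _ _ aqp); have := gapd _ _ aqp.
  by move: pn; rewrite -natr1 mulrDr mulr1; lra.
have := fspanD rq (fspan_hat z theta ka aqp aps).
congr (fspan _ _); apply/funext => t; rewrite /ramp /hat addrA; congr (_ + _).
have := affine_in t qp.
have [tq|qt] := ltP t q => /=.
  move=> /negbT out; rewrite lfun_out// rfun_out// addr0 addr0.
  by rewrite (lt_trans tq qp).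
have [tp|pt] := ltP t p => /= In; last first.
  by move/negbT: In => out; rewrite lfun_out// rfun_out// !andbF !addr0.
(* On [q, p[ the falling part of the ramp and the rising part of the hat add up to 1. *)
by rewrite lfun_in// rfun_in// (le_trans q0 qt)/=; ring.
Qed.

(** On [p, s[ both functions take values in [0, 1]; elsewhere on the half-line they agree. The
    negative reals, where the indicator is 1 and the ramp 0, are null for [leb_pos]. *)
Lemma ramp_error p c s t : 0 <= p -> p <= c < s ->
  (\1_(`]-oo, c[) t - ramp p s t) ^+ 2 <= \1_(`]-oo, 0[ `|` `[p, s[) t :> R.
Proof.
move=> p0 /andP[pc cs]; have ps := le_lt_trans pc cs.
rewrite !indicE in_setU !mem_setE !in_itv /= /ramp; have := affine_in t ps.
have [t0|t0] := ltP t 0 => /=.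
  rewrite [p <= t]leNgt (lt_le_trans t0 p0) => /negbT out.
  by rewrite lfun_out// (lt_le_trans t0 (le_trans p0 pc)) /= addr0 subr0 expr1n.
have [tp|pt] := ltP t p => /=.
  by move=> /negbT out; rewrite lfun_out// (lt_le_trans tp pc) addr0 subrr expr0n.
have [ts|st] := ltP t s => /= In; last first.
  move/negbT: In => out; rewrite lfun_out// ltNge (ltW (lt_le_trans cs st)) /=.
  by rewrite addr0 subrr expr0n.
rewrite lfun_in//; case/andP: In => v0 v1.
by case: (t < c) => /=; rewrite ?mulr1n ?mulr0n; nra.
Qed.

(** Only the generators of the first interval and the hat peaked at [s] are nonzero there. The range
    stops at [theta * s], the break point of z on the first interval. *)
Lemma fspan_Omega_quad s : 0 < theta < 1 -> consecutive a 0 s -> forall f, fspan Om f ->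
  exists A B C, forall t, 0 <= t < theta * s -> f t = quad A B C t.
Proof.
move=> t01 a0s; have [t0 t1] := andP t01.
have [_ a_ge0 _ _] := ka; have [_ _ s0 gap] := a0s.
have sn0 : s != 0 by rewrite gt_eqF.
have tn0 : theta != 0 by rewrite gt_eqF.
pose Q := [set f : R -> R | exists A B C, forall t, 0 <= t < theta * s -> f t = quad A B C t].
suff H : Om `<=` fspan Q.
  move=> f /(fspan_min H); move: f; apply: fspan_ind.
    by exists 0, 0, 0 => t _; rewrite /quad !mul0r !addr0.
  move=> c f g [A [B [C fE]]] [A' [B' [C' gE]]].
  exists (c * A + A'), (c * B + B'), (c * C + C') => t ht.
  by rewrite fE// gE// /quad; ring.
have zero f : (forall t, 0 <= t < theta * s -> f t = 0) -> Q f.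
  by move=> f0; exists 0, 0, 0 => t ht; rewrite f0// /quad !mul0r !addr0.
have tss : theta * s < s by rewrite gtr_pMl.
have far p q t : s <= p -> p < q -> 0 <= t < theta * s -> ~~ (0 <= affine p q t < 1).
  move=> sp pq /andP[_ ts]; rewrite affine_in// negb_and -ltNge.
  by rewrite (lt_le_trans _ sp)// (lt_trans ts).
have cases p q : consecutive a p q -> (p = 0 /\ q = s) \/ s <= p.
  move=> /[dup] apq [ap _ _ _]; have := a_ge0 p ap; rewrite le_eqVlt => /predU1P[p0|p0].
    by left; subst p; rewrite -(knot_succE apq) (knot_succE a0s).
  by right; exact: gap.
have near0 t : 0 <= t < theta * s -> 0 <= affine 0 s t < theta.
  by rewrite /affine !subr0 => /andP[h1 h2]; rewrite divr_ge0 ?(ltW s0)//= ltr_pdivrMr.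
have near1 t : 0 <= t < theta * s -> 0 <= affine 0 s t < 1.
  by move=> /near0 /andP[-> h]; rewrite (lt_trans h).
apply: (Omega_sub_fspan ka).
- move=> p q /[dup] apq [_ _ pq _]; apply: fspan_gen.
  have [[-> ->]|sp] := cases _ _ apq; last first.
    by apply: zero => t ht; rewrite qfun_out// far.
  exists 0, (4 / s), (- 4 / s ^+ 2) => t /near1 ht.
  by rewrite qfun_in// /affine /quad; field.
- move=> p q /[dup] apq [_ _ pq _].
  have [c [d [e zE]]] := fspan3P zt.
  apply: fspan_gen; have [[-> ->]|sp] := cases _ _ apq; last first.
    apply: zero => t /(far _ _ _ sp pq) out; rewrite zE.
    have [qE lE rE] := two_scale (affine p q t) t01.
    have outl : ~~ (0 <= affine p q t / theta < 1).
      rewrite itv_left//; apply: contra out => /andP[-> h].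
      by rewrite (lt_trans h).
    have outr : ~~ (0 <= (affine p q t - theta) / (1 - theta) < 1).
      rewrite itv_right//; apply: contra out => /andP[h ->].
      by rewrite (le_trans (ltW t0)).
    by rewrite /q0 /q1 /hfun !(qfun_out outl, qfun_out outr, rfun_out outl, lfun_out outr); ring.
  exists 0, (4 * c / (theta * s) + e / (theta * s)), (- 4 * c / (theta * s) ^+ 2).
  move=> t /near0 ht; rewrite zE.
  have inl : 0 <= affine 0 s t / theta < 1 by rewrite itv_left.
  have outr : ~~ (0 <= (affine 0 s t - theta) / (1 - theta) < 1).
    by rewrite itv_right// negb_and -ltNge; case/andP: ht => _ ->.
  rewrite /q0 /q1 /hfun !(qfun_in inl, qfun_out outr, rfun_in inl, lfun_out outr).
  by rewrite /affine /quad; field; rewrite sn0.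
- move=> q /[dup] apq [_ _ pq _]; apply: fspan_gen.
  have [[_ ->]|sp] := cases _ _ apq; last by rewrite leNgt s0 in sp.
  exists 1, (- 1 / s), 0 => t /near1 ht.
  by rewrite lfun_in// /affine /quad; field.
- move=> p x q /[dup] apx [ap _ px _] /[dup] axq [_ _ xq _]; apply: fspan_gen.
  have sx : s <= x.
    have [[x0 _]|//] := cases _ _ axq.
    by have := a_ge0 p ap; rewrite leNgt -x0 px.
  have [[p0 xs]|sp] := cases _ _ apx; last first.
    by apply: zero => t ht; rewrite /hat rfun_out ?far// lfun_out ?far// addr0.
  exists 0, s^-1, 0 => t ht; rewrite /hat [X in _ + X]lfun_out ?far// p0 xs.
  by rewrite rfun_in ?near1// /affine /quad; field.
Qed.

End OmegaProperties.

(** * The spaces V^k: nesting, density of the union, trivial intersection *)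

Section Multiresolution.
Variables (R : realType) (z : R -> R -> R).
Local Notation tau := (tau R).
Local Notation mu := (leb_pos R).
Hypothesis zt : fspan [set q0 tau^-1; q1 tau^-1; hfun tau^-1] (z tau^-1).
Implicit Types (k m : int) (f g : R -> R).

Let scale k : R := tau ^ (- k).
Local Notation Om k := (Omega z (@tau_knots R k) (fun=> tau^-1)).
Local Notation V := (Vspace z).

Lemma tauV_01 : 0 < tau^-1 < 1.
Proof. by rewrite invr_gt0 tau_gt0 invf_lt1 ?tau_gt0// tau_gt1. Qed.

Let scale_gt0 k : 0 < scale k. Proof. by rewrite exprz_gt0// tau_gt0. Qed.

Let knots k : knot_seq (@tau_knots R k). Proof. exact: (scaled_knot_seq (scale_gt0 k)). Qed.

Let scale_step k : scale k = scale (k + 1) * tau.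
Proof.
by rewrite /scale opprD expfzDr ?lt0r_neq0 ?tau_gt0// exprN1 divfK// lt0r_neq0// tau_gt0.
Qed.

Lemma measurable_Om k f : fspan (Om k) f -> measurable_fun setT f.
Proof. exact: measurable_fspan_Omega. Qed.

Lemma Vspace_step k : V k `<=` V (k + 1).
Proof.
apply: L2closure_mono; apply: fspan_Omega_refine => //; first exact: tauV_01.
by have := scaled_refines (scale_gt0 (k + 1)); rewrite -scale_step.
Qed.

Lemma Vspace_mono k m : k <= m -> V k `<=` V m.
Proof.
rewrite -subr_ge0; case mk : (m - k) => [n|//] _.
have -> : m = k + n by rewrite -mk addrC subrK.
elim: n {mk} => [|n IH]; first by rewrite addr0.
by apply: subset_trans IH _; rewrite -addn1 PoszD addrA; exact: Vspace_step.
Qed.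

Lemma Vspace_lin k c f g : V k f -> V k g -> V k (fun x => c * f x + g x).
Proof.
apply: L2closure_lin; first exact: measurable_Om.
by move=> d f' g' Of Og; apply: fspanD => //; exact: fspanZ.
Qed.

Let VU := \bigcup_(k in [set: int]) V k.

Let mVU f : VU f -> measurable_fun setT f.
Proof. by move=> [k _ /L2closureP[/Lfun2P[]]]. Qed.

Let linVU c f g : VU f -> VU g -> VU (fun x => c * f x + g x).
Proof.
move=> [k _ Vf] [m _ Vg]; have [km|/ltW mk] := leP k m.
  by exists m => //; apply: Vspace_lin => //; exact: Vspace_mono Vf.
by exists k => //; apply: Vspace_lin => //; exact: Vspace_mono Vg.
Qed.

Let VU0 : VU (cst 0).
Proof.
exists 0 => //; apply: L2closure0 => //; exact: fspan0.
Qed.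

Let small_scale e : 0 < e -> exists k, scale k < e.
Proof.
move=> e0; have [n en] := tau_pow_unbounded (e^-1); exists n.
rewrite /scale -exprz_inv -exprnP exprVn invf_plt ?posrE// exprn_gt0//.
exact: tau_gt0.
Qed.

Let large_scale c : exists k, c < scale k.
Proof.
have [n cn] := tau_pow_unbounded c; exists (- n%:Z).
by rewrite /scale opprK.
Qed.

Lemma Vspace_rays c : L2closure mu VU \1_(`]-oo, c[).
Proof.
have mray r : measurable_fun setT (\1_(`]-oo, r[) : measurableTypeR R -> R).
  exact: measurable_indic.
have [c0|c0] := leP c 0.
  (* For [c <= 0] the indicator lives on the negative reals, a null set for [leb_pos]. *)
  apply: (@L2closure_ae_eq _ _ _ mVU (cst 0)) => //; first exact: L2closure0.
  apply/eqP; rewrite eq_le sqnorm_ge0 andbT.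
  under eq_fun do rewrite subr0.
  have le0 x : \1_(`]-oo, c[) x ^+ 2 <= \1_(`]-oo, 0[) x :> R.
    rewrite !indicE !mem_setE !in_itv/=.
    have [xc|] := ltP x c; last by rewrite expr0n.
    by rewrite (lt_le_trans xc c0) expr1n.
  apply: (le_trans (sqnorm_leb_pos_indic (mray c) _ le0)); first exact: measurable_itv.
  rewrite (_ : _ `&` _ = set0) ?measure0//.
  by apply/seteqP; split => // x [] /=; rewrite !in_itv/= andbT leNgt => ->.
have Lray : \1_(`]-oo, c[) \in Lfun mu 2%:E.
  apply/Lfun2P; split => //.
  apply: (@le_lt_trans _ _ (@lebesgue_measure R (`]-oo, c[ `&` `[0, +oo[))).
    apply: sqnorm_leb_pos_indic => // x.
    by rewrite indicE; case: (_ \in _); rewrite ?expr1n ?expr0n.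
  apply: (@le_lt_trans _ _ (@lebesgue_measure R `[0, c[)).
    apply: le_measure; rewrite ?inE//; first exact: measurableI.
    by move=> x [] /=; rewrite !in_itv/= andbT => -> ->.
  by rewrite lebesgue_measure_itv/= lte_fin c0 -EFinB ltry.
(* The squared error of the ramp is at most the length of the knot interval containing [c], hence at
   most [scale k]. *)
apply: L2closure_lim => // e e0; have [k ke] := small_scale e0.
have [p [s [aps pcs]]] := scaled_cover (scale_gt0 k) (ltW c0).
have [pc cs] := andP pcs.
have p0 : 0 <= p by have [_ h _ _] := knots k; case: aps => /h.
have /andP[_ sp] := scaled_gap (scale_gt0 k) aps.
have Or : fspan (Om k) (ramp p s).
  apply: (@fspan_ramp _ z _ tau^-1 (knots k) (scale k / tau)) => //.
    by rewrite divr_gt0// tau_gt0.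
  by move=> q r /(scaled_gap (scale_gt0 k)) /andP[].
have mr := measurable_Om Or.
have mS : measurable (`]-oo, 0[ `|` `[p, s[ : set R) by exact: measurableU.
have sqr_le : (sqnorm mu (fun x => \1_(`]-oo, c[) x - ramp p s x)%R <= (scale k)%:E)%E.
  apply: le_trans (sqnorm_leb_pos_indic _ mS _) _; first exact: measurable_funB.
    by move=> x; exact: ramp_error.
  apply: (@le_trans _ _ (@lebesgue_measure R `[p, s[)).
    apply: le_measure; rewrite ?inE//; first exact: measurableI.
    by move=> x [] /=; rewrite !in_itv/= andbT => -[|//]; rewrite ltNge => /negbTE ->.
  by rewrite lebesgue_measure_itv/= lte_fin (le_lt_trans pc cs) -EFinB lee_fin.
exists (ramp p s); last by apply: le_lt_trans sqr_le _; rewrite lte_fin.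
(* The ramp is square integrable because the indicator and their difference are. *)
have Lr : ramp p s \in Lfun mu 2%:E.
  have -> : ramp p s = (fun x => - 1 * (\1_(`]-oo, c[) x - ramp p s x) + \1_(`]-oo, c[) x).
    by apply/funext => x; ring.
  apply: Lfun2_lin => //; apply/Lfun2P; split; first exact: measurable_funB.
  by apply: le_lt_trans sqr_le _; rewrite ltry.
by apply: sub_L2closure => //; exists k => //; exact: sub_L2closure.
Qed.

Lemma Vspace_dense f : f \in Lfun mu 2%:E -> L2closure mu VU f.
Proof. exact: (L2closure_full mVU VU0 linVU Vspace_rays). Qed.

(** With [g] near [f] in the span at a coarse scale, the mass of [f] on [0, T] is at most twice that
    of [f - g] plus twice that of [g]; each of these two masses is made at most [e / 4]. *)
Lemma sqnorm_seg_bigcap f T : 0 < T -> (forall k, V k f) ->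
  sqnorm (leb_seg T) f = 0%E.
Proof.
move=> T0 Vf; have /L2closureP[/Lfun2P[mf sf] _] := Vf 0.
have t0 := @tau_gt0 R; have tn0 := lt0r_neq0 t0.
apply/eqP; rewrite eq_le sqnorm_ge0 andbT; apply/lee_addgt0Pr => e e0.
rewrite add0e.
(* K is abstract because conversion would unfold 3000 to a sum of ones. *)
have [K [K0 KE]] : exists K : R, 0 < K /\ K = 3000.
  by exists 3000; split; [rewrite ltr0n|reflexivity].
pose N := fine (sqnorm mu f).
have N0 : 0 <= N by rewrite fine_ge0// sqnorm_ge0.
have fE : sqnorm mu f = N%:E by rewrite fineK// ge0_fin_numE// sqnorm_ge0.
(* The summand 1 gives [T <= M]; the other makes [K * (T / L) * (2 * N + 2) <= e / 4] as soon as [L]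
   exceeds [M]. *)
pose M := T * (1 + K * 4 * (2 * N + 2) / e).
have [k Mk] := large_scale (2 * tau * M).
(* Half of the range on which [g] is polynomial, so that the closed segment [0, L] fits into the
   half-open one. *)
pose L := tau^-1 * scale k / 2.
have ML : M < L by rewrite /L -mulrA ltr_pdivlMl//; lra.
have M1 : T * (K * 4 * (2 * N + 2)) <= M * e.
  have -> : M * e = T * (e + K * 4 * (2 * N + 2)).
    by rewrite /M; field; rewrite gt_eqF.
  by rewrite ler_pM2l// lerDr ltW.
have TM : T <= M.
  have h : 0 <= K * 4 * (2 * N + 2) / e.
    by apply: divr_ge0; [apply: mulr_ge0|exact: ltW]; lra.
  by rewrite -[leLHS]mulr1 /M ler_pM2l// lerDl.
have L0 : 0 < L by exact: lt_trans (lt_le_trans T0 TM) ML.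
(* The bound 1 gives [sqnorm mu g <= 2 * N + 2] whatever [k] is; the bound [e / 4] controls
   [f - g]. *)
pose eta := Num.min 1 (e / 4).
have eta0 : 0 < eta by rewrite lt_min ltr01 divr_gt0.
have eta1 : eta <= 1 by rewrite ge_min lexx.
have eta2 : eta <= e / 4 by rewrite ge_min lexx orbT.
have /L2closureP[_ /(_ _ eta0)[g Og fg]] := Vf k.
have mg := measurable_Om Og.
have mfg : measurable_fun setT (fun x : measurableTypeR R => f x - g x).
  exact: measurable_funB.
have mgf : measurable_fun setT (fun x : measurableTypeR R => - 1 * (f x - g x)).
  exact: measurable_funM.
have sg : (sqnorm mu g <= (2 * N + 2)%:E)%E.
  have gE : g = (fun x => - 1 * (f x - g x) + f x) by apply/funext => x; ring.
  rewrite [in leLHS]gE; apply: (le_trans (sqnormD mu mgf mf)).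
  rewrite sqnormZ// fE sqrrN expr1n mul1e.
  have -> : (2 * N + 2)%:E = (2%:E * 1%:E + 2%:E * N%:E)%E.
    by rewrite -!EFinM -EFinD; congr EFin; ring.
  rewrite leeD2r// lee_pmul2l//.
  by apply: le_trans (ltW fg) _; rewrite lee_fin.
have [A [B [C gq]]] := fspan_Omega_quad (knots k) zt tauV_01 (scaled_first (scale_gt0 k)) Og.
have segg : (sqnorm (leb_seg T) g <= (K * (T / L) * (2 * N + 2))%:E)%E.
  apply: (le_trans (@sqnorm_seg_quad _ g A B C T L mg _ _)).
  - by rewrite T0 (le_trans TM)// ltW.
  - move=> t /andP[t0' tL]; apply: gq; rewrite t0' (le_lt_trans tL)//.
    have : 0 < tau^-1 * scale k by rewrite mulr_gt0// invr_gt0.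
    by rewrite /L; lra.
  - rewrite -KE [leRHS]EFinM; apply: lee_wpmul2l.
      by rewrite lee_fin; apply: mulr_ge0; [|apply: divr_ge0]; exact: ltW.
    by apply: le_trans sg; exact: sqnorm_leb_seg_le.
have fE' : f = (fun x => (f x - g x) + g x) by apply/funext => x; ring.
rewrite [in leLHS]fE'; apply: (le_trans (sqnormD _ mfg mg)).
apply: (@le_trans _ _ (2%:E * eta%:E + 2%:E * (K * (T / L) * (2 * N + 2))%:E)%E).
  apply: leeD; rewrite lee_pmul2l//.
  by apply: le_trans (ltW fg); exact: sqnorm_leb_seg_le.
rewrite -!EFinM -EFinD lee_fin.
have : K * (T / L) * (2 * N + 2) <= e / 4.
  have -> : K * (T / L) * (2 * N + 2) = T * (K * (2 * N + 2)) / L by ring.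
  rewrite ler_pdivrMr//.
  have : M * e <= L * e by rewrite ler_pM2r// ltW.
  by lra.
lra.
Qed.

Lemma Vspace_bigcap_ae0 f : (forall k, V k f) -> f = cst 0 %[ae mu].
Proof.
move=> Vf; have /L2closureP[/Lfun2P[mf _] _] := Vf 0.
have : \forall x \ae (@lebesgue_measure R), forall n, `[0, n.+1%:R]%classic x -> f x = 0.
  apply: ae_foralln => n; have := @sqnorm_seg_bigcap f n.+1%:R (ltr0Sn _ _) Vf.
  rewrite sqnorm_leb_seg// => h.
  have mf2 : measurable_fun `[0 : R, n.+1%:R] (fun x : measurableTypeR R => (f x ^+ 2)%:E).
    by apply: measurable_funTS; exact: measurable_sqrR.
  have [+ _] := ae_eq_integral_abs (@lebesgue_measure R) (measurable_itv _) mf2.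
  have -> : (\int[@lebesgue_measure R]_(x in `[0%R, n.+1%:R]) `|(f x ^+ 2)%:E| = 0)%E.
    by rewrite -[RHS]h; apply: eq_integral => x _; rewrite gee0_abs// lee_fin sqr_ge0.
  move=> /(_ erefl).
  apply: filterS => x h' /h' /= [] /eqP.
  by rewrite sqrf_eq0 => /eqP.
(* Vanishing is known on each [0, n + 1] up to a Lebesgue null set; the negative reals join the
   exceptional set, being null for [leb_pos]. *)
move=> [N [mN N0 sub]]; exists (N `|` `]-oo, 0[); split.
- by apply: measurableU.
- apply/eqP; rewrite eq_le measure_ge0 andbT -N0 /leb_pos /mrestr /=.
  apply: le_measure; rewrite ?inE//.
    by apply: measurableI => //; apply: measurableU.
  move=> x [] [//|] /=; rewrite !in_itv/= andbT => x0.
  by rewrite leNgt x0.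
- move=> x /= fx; have [x0|x0] := ltP x 0; first by right; rewrite /= in_itv.
  left; apply: sub => /= hx; apply: fx => _; apply: (hx (Num.bound x)).
  rewrite /= in_itv/= x0/= ltW// (lt_le_trans (archi_boundP x0))// ler_nat.
  exact: leqnSn.
Qed.

Lemma ae0_Vspace k f : f \in Lfun mu 2%:E -> f = cst 0 %[ae mu] -> V k f.
Proof.
move=> /Lfun2P[mf _] f0.
have mO : forall f, fspan (Om k) f -> measurable_fun setT f by exact: measurable_Om.
apply: (L2closure_ae_eq mO (L2closure0 mu (fspan0 _)) mf).
under eq_fun do rewrite subr0.
rewrite /sqnorm (ae_eq_integral (cst 0%E))//; first by rewrite integral0.
- exact: measurable_sqrR.
- move: f0 => [N [mN N0 sub]]; exists N; split => // x /= h; apply: sub => h'.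
  by apply: h => _; rewrite h'// expr0n.
Qed.

End Multiresolution.

Theorem mainTheorem5 (R : realType) (z : R -> R -> R)
    (hz : forall theta : R, 0 < theta < 1 -> admissible_z theta (z theta)) :
  [/\ forall k : int, Vspace z k `<=` Vspace z (k + 1),
      L2closure (leb_pos R) (\bigcup_(k in [set: int]) Vspace z k)
        = [set f | f \in Lfun (leb_pos R) 2%:E] &
      \bigcap_(k in [set: int]) Vspace z k
        = [set f | f \in Lfun (leb_pos R) 2%:E /\ f = cst 0 %[ae leb_pos R]]].
Proof.
have [zt _ _ _] := hz _ (@tauV_01 R); split.
- exact: Vspace_step.
- apply/seteqP; split => f; first by case.
  exact: Vspace_dense.
- apply/seteqP; split => f.
    move=> Vf; have Vf' k : Vspace z k f by exact: Vf.
    by split; [case: (Vf' 0)|exact: (Vspace_bigcap_ae0 zt Vf')].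
  by move=> [Lf f0] k _; exact: ae0_Vspace.
Qed.
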